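(* Let $q=p^s>3$ be a prime power ($p$ prime) with $q\equiv 3\bmod 4$, and let $\Phi_q$ be the Paley ETF. Let $M^{\{b\}}$ ($b\in\mathbb{F}_q$) be the Paley modulations, $T=T_{(q-1)/2}$ the cyclic translation matrix, and $\Pi=\Pi_q$ the Galois permutation. Then $$G:=\{M^{\{b\}}T^\ell\Pi^k : b\in\mathbb{F}_q,\ \ell\in\{0,\dots,(q-3)/2\},\ k\in\{0,\dots,s-1\}\}$$ $$\cong\left((\mathbb{Z}_p)^s\rtimes\mathbb{Z}_{(q-1)/2}\right)\rtimes\mathbb{Z}_s\cong\{f\in\operatorname{A\Gamma L}(\mathbb{F}_q): f(x)=mx^\sigma+b,\ b\in\mathbb{F}_q,\ m\in\operatorname{QR}(\mathbb{F}_q),\ \sigma\in\operatorname{Aut}(\mathbb{F}_q)\}$$ is the group of vector automorphisms of $\Phi_q$. The vector and line symmetry groups satisfy $\operatorname{Sym}_v(\Phi_q)=\operatorname{Sym}_\ell(\Phi_q)\cong G$. The symmetry groups act $2$-homogeneously but not $2$-transitively on the vectors and the lines.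
   Context: $\mathbb{F}_q$ is constructed as $\mathbb{F}_p[X]/(\pi(X))=\mathbb{F}_p(\alpha)$ with $\pi$ monic irreducible of degree $s$ and $\pi(\alpha)=0$, where $\pi$ is chosen so that $\alpha$ is a primitive element (generator of $\mathbb{F}_q^\times$). $\mathbb{F}_q$ is identified with $\mathbb{F}_p^s$ through coordinates in the basis $\alpha^0,\alpha^1,\dots,\alpha^{s-1}$, and $\langle x,y\rangle_p=\sum_{i=0}^{s-1}x_iy_i\in\mathbb{F}_p$ for the coordinate vectors of $x,y$. $\operatorname{QR}(\mathbb{F}_q)=\{x^2:x\in\mathbb{F}_q^\times\}=\{\alpha^{2k}: 0\le k\le (q-3)/2\}$. $\operatorname{A\Gamma L}(\mathbb{F}_q)$ is the group under composition of all maps $f:\mathbb{F}_q\to\mathbb{F}_q$, $f(x)=mx^\sigma+b$, with $m\in\mathbb{F}_q^\times$, $b\in\mathbb{F}_q$, $\sigma\in\operatorname{Aut}(\mathbb{F}_q)$, where $x^\sigma=\sigma(x)$. In the iterated semidirect product, $\mathbb{Z}_{(q-1)/2}\cong\operatorname{QR}(\mathbb{F}_q)$ acts on $(\mathbb{Z}_p)^s\cong(\mathbb{F}_q,+)$ by multiplication and $\mathbb{Z}_s\cong\operatorname{Aut}(\mathbb{F}_q)$ acts by field automorphisms. Paley ETF: with $\zeta\in\mathbb{C}$ a primitive $p$th root of unity, $\Phi_q$ is the $(q-1)/2\times q$ complex matrix with rows indexed, in this order, by $\alpha^0,\alpha^2,\dots,\alpha^{q-3}$, columns indexed by $\mathbb{F}_q$,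 and entry $\zeta^{\langle x,y\rangle_p}$ in row $x$, column $y$. Its columns $(\varphi_y)_{y\in\mathbb{F}_q}$ are the frame vectors in $\mathbb{C}^{(q-1)/2}$; they form an equiangular tight frame. Operators on $\mathbb{C}^{(q-1)/2}$ (coordinates indexed $0,\dots,(q-3)/2$): $M^{\{b\}}$ is the diagonal matrix whose diagonal entries are the entries of $\varphi_b$; $T$ is the permutation matrix sending the $i$th standard basis vector to the $(i+1)$st, indices mod $(q-1)/2$; $\Pi$ is the permutation matrix mapping coordinate $\ell$ to coordinate $p\ell \bmod (q-1)/2$. For a frame $\Phi=(\varphi_j)_{j=1}^n$ of $\mathbb{C}^d$, a unitary $U\in \operatorname{U}(d)$ is a vector automorphism if there is $\sigma\in S_n$ with $U\varphi_j=\varphi_{\sigma(j)}$ for all $j$; it is a line automorphism if there is $\sigma\in S_n$ with $U\varphi_j\varphi_j^*U^*=\varphi_{\sigma(j)}\varphi_{\sigma(j)}^*$ for all $j$. The vector symmetry group $\operatorname{Sym}_v(\Phi)$ (resp. line symmetry group $\operatorname{Sym}_\ell(\Phi)$) is the subgroup of $S_n$ of permutations induced by vector (resp. line) automorphisms. Here the index set is $\mathbb{F}_q$. An action of a group on a set is $k$-transitive if any ordered $k$-tuple of distinct elements can be mapped by some group element to any other such ordered $k$-tuple; it is $k$-homogeneous if any $k$-element subset can be mapped by some group element onto any other $k$-element subset. *)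

(* Defs.v *)
From mathcomp Require Import all_boot all_order all_fingroup all_algebra.
From mathcomp Require Import all_solvable all_field.
From mathcomp Require Import all_classical reals complex.
Set Implicit Arguments.
Unset Strict Implicit.
Unset Printing Implicit Defensive.
Import GroupScope Order.TTheory GRing.Theory Num.Theory FinRing.Theory.
Local Open Scope ring_scope.
Local Open Scope sesquilinear_scope.
Local Open Scope complex_scope.

Section Generalities.

(* [G] is a set of invertible matrices and f is an isomorphism from the finite
   group A onto G, the group law of G being the matrix product.  The clause at 1
   excludes images of A under which 1 is a nontrivial idempotent. *)
Definition mx_isog (gT : finGroupType) (A : {group gT}) (K : fieldType) n
    (G : set 'M[K]_n) : Prop :=
  exists f : gT -> 'M[K]_n,
    [/\ f 1%g = 1%:M,
        {in A &, {morph f : x y / (x * y)%g >-> x *m y}}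
      & set_bij [set` A] G f].

Definition homogeneous (aT : finGroupType) (T : finType) (k : nat)
    (A : {set aT}) (S : {set T}) (to : {action aT &-> T}) : Prop :=
  forall X Y : {set T}, X \subset S -> Y \subset S -> #|X| = k -> #|Y| = k ->
  exists2 a, a \in A & (to^*)%act X a = Y.

Definition primitive_element (F : finFieldType) (a : F) : Prop :=
  forall x : F, x != 0 -> exists k, x = a ^+ k.

End Generalities.

(* The product of permutations in {perm J} is composition from left to right:
   (s * t) x = t (s x).  The symmetry groups below and the groups of affine maps
   are thus the opposites of the same sets under [\o], to which they are
   isomorphic by inversion. *)
Section Symmetry.

Variables (C : numClosedFieldType) (J : finType) (d : nat).
Variable Phi : J -> 'cV[C]_d.

Definition line (j : J) : 'M[C]_d := Phi j *m (Phi j)^t*.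

Definition vector_induces (U : 'M[C]_d) (s : {perm J}) : Prop :=
  forall j, U *m Phi j = Phi (s j).

Definition line_induces (U : 'M[C]_d) (s : {perm J}) : Prop :=
  forall j, U *m Phi j *m (Phi j)^t* *m U^t* = line (s j).

Definition vector_automorphism (U : 'M[C]_d) : Prop :=
  U \is unitarymx /\ exists s, vector_induces U s.

Definition Sym_v_set : {set {perm J}} :=
  [set s | `[< exists2 U, U \is unitarymx & vector_induces U s >]].

Definition Sym_l_set : {set {perm J}} :=
  [set s | `[< exists2 U, U \is unitarymx & line_induces U s >]].

Lemma unitary1 : (1%:M : 'M[C]_d) \is unitarymx.
Proof. by apply/unitarymxP; rewrite mul1mx trmx1 map_mx1. Qed.

Lemma Sym_v_group_set : group_set Sym_v_set.
Proof.
apply/group_setP; split.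
  rewrite !inE; exists 1%:M; first exact: unitary1.
  by move=> j; rewrite mul1mx perm1.
move=> s t; rewrite !inE => -[U uU Us] [V uV Vt].
exists (V *m U); first by rewrite mul_unitarymx.
by move=> j; rewrite -mulmxA Us Vt permM.
Qed.
Canonical Sym_v := Group Sym_v_group_set.

Lemma Sym_l_group_set : group_set Sym_l_set.
Proof.
apply/group_setP; split.
  rewrite !inE; exists 1%:M; first exact: unitary1.
  by move=> j; rewrite mul1mx perm1 trmx1 map_mx1 mulmx1.
move=> s t; rewrite !inE => -[U uU Us] [V uV Vt].
exists (V *m U); first by rewrite mul_unitarymx.
move=> j; rewrite trmx_mul map_mxM /= permM -Vt.
by rewrite -(mulmxA V (Phi _)) -/(line _) -Us !mulmxA.
Qed.
Canonical Sym_l := Group Sym_l_group_set.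

End Symmetry.

Section AffineSemilinear.

Variable F : finFieldType.

Definition field_aut_set : {set {perm F}} :=
  [set s : {perm F} |
     [forall x, forall y, (s (x + y) == s x + s y) && (s (x * y) == s x * s y)]].

Definition QR : {set F} := [set x ^+ 2 | x in [pred x : F | x != 0]].

Definition affine_semilinear (m b : F) (s f : {perm F}) : bool :=
  [forall x, f x == m * s x + b].

Definition AGammaL_set : {set {perm F}} :=
  [set f | [exists m, exists b, exists s,
     [&& m != 0, s \in field_aut_set & affine_semilinear m b s f]]].

Definition AGammaL_QR_set : {set {perm F}} :=
  [set f in AGammaL_set | [exists m, exists b, exists s,
     [&& m \in QR, s \in field_aut_set & affine_semilinear m b s f]]].

Lemma field_autP (s : {perm F}) :
  reflect ((forall x y, s (x + y) = s x + s y) /\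
           (forall x y, s (x * y) = s x * s y)) (s \in field_aut_set).
Proof.
rewrite inE; apply: (iffP forallP) => [H|[Ha Hm] x]; last first.
  by apply/forallP => y; rewrite Ha Hm !eqxx.
by split=> x y; have /forallP/(_ y)/andP[/eqP ? /eqP ?] := H x.
Qed.

Lemma field_aut_group_set : group_set field_aut_set.
Proof.
apply/group_setP; split; first by apply/field_autP; split=> x y; rewrite !perm1.
move=> s t /field_autP[sD sM] /field_autP[tD tM].
by apply/field_autP; split=> x y; rewrite !permM ?sD ?sM ?tD ?tM.
Qed.
Canonical field_aut := Group field_aut_group_set.

Lemma QR_M x y : x \in QR -> y \in QR -> x * y \in QR.
Proof.
move=> /imsetP[a a0 ->] /imsetP[b b0 ->]; rewrite -exprMn; apply: imset_f.
by rewrite inE mulf_neq0.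
Qed.

Lemma field_aut_neq0 s x : s \in field_aut_set -> x != 0 -> s x != 0.
Proof.
move=> /field_autP[_ sM]; apply: contra => /eqP sx0.
by apply/eqP/(@perm_inj _ s); rewrite sx0 -[0 in RHS](mulr0 x) sM sx0 mul0r.
Qed.

Lemma field_aut_QR s x : s \in field_aut_set -> x \in QR -> s x \in QR.
Proof.
move=> sA /imsetP[a a0 ->]; have /field_autP[_ sM] := sA.
by rewrite expr2 sM -expr2; apply: imset_f; rewrite inE field_aut_neq0.
Qed.

Lemma affine1 : affine_semilinear 1 0 1%g 1%g.
Proof. by apply/forallP=> x; rewrite !perm1 mul1r addr0. Qed.

Lemma affineM m b s f m' b' s' f' : s' \in field_aut_set ->
  affine_semilinear m b s f -> affine_semilinear m' b' s' f' ->
  affine_semilinear (m' * s' m) (m' * s' b + b') (s * s')%g (f * f')%g.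
Proof.
move=> /field_autP[sD sM] /forallP Hf /forallP Hf'; apply/forallP => x.
by rewrite !permM (eqP (Hf' _)) (eqP (Hf _)) sD sM mulrDr mulrA addrA.
Qed.

Lemma AGammaLP f :
  reflect (exists m b s,
     [/\ m != 0, s \in field_aut_set & affine_semilinear m b s f])
  (f \in AGammaL_set).
Proof.
rewrite inE; apply: (iffP existsP) => [[m]|[m [b [s H]]]].
  by move=> /existsP[b] /existsP[s] /and3P H; exists m, b, s.
by exists m; apply/existsP; exists b; apply/existsP; exists s; apply/and3P.
Qed.

Lemma AGammaL_group_set : group_set AGammaL_set.
Proof.
apply/group_setP; split.
  by apply/AGammaLP; exists 1, 0, 1%g; rewrite oner_eq0 group1 affine1.
move=> f g /AGammaLP[m [b [s [m0 sA Hf]]]] /AGammaLP[m' [b' [s' [m0' sA' Hg]]]].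
apply/AGammaLP; exists (m' * s' m), (m' * s' b + b'), (s * s')%g.
by rewrite mulf_neq0 ?field_aut_neq0 // groupM //; split=> //; exact: affineM.
Qed.
Canonical AGammaL := Group AGammaL_group_set.

Lemma AGammaL_QRP f :
  reflect (exists m b s,
     [/\ m \in QR, s \in field_aut_set & affine_semilinear m b s f])
  (f \in AGammaL_QR_set).
Proof.
rewrite inE; apply: (iffP andP) => [[_ /existsP[m]]|[m [b [s H]]]].
  by move=> /existsP[b] /existsP[s] /and3P H; exists m, b, s.
split; last first.
  apply/existsP; exists m; apply/existsP; exists b; apply/existsP; exists s.
  exact/and3P.
have [/imsetP[a a0 Em] sA sf] := H.
by apply/AGammaLP; exists m, b, s; split=> //; rewrite Em expf_neq0.
Qed.

Lemma AGammaL_QR_group_set : group_set AGammaL_QR_set.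
Proof.
apply/group_setP; split.
  apply/AGammaL_QRP; exists 1, 0, 1%g; rewrite group1 affine1; split=> //.
  by rewrite -(expr1n _ 2); apply: imset_f; rewrite inE oner_eq0.
move=> f g /AGammaL_QRP[m [b [s [m0 sA Hf]]]].
move=> /AGammaL_QRP[m' [b' [s' [m0' sA' Hg]]]].
apply/AGammaL_QRP; exists (m' * s' m), (m' * s' b + b'), (s * s')%g.
by rewrite QR_M ?field_aut_QR // groupM //; split=> //; exact: affineM.
Qed.
Canonical AGammaL_QR := Group AGammaL_QR_group_set.

End AffineSemilinear.

Section Paley.

Variables (p s : nat) (pi : {poly 'F_p}) (mi : monic_irreducible_poly pi).
Local Notation F := {poly %/ pi with mi}.
Local Notation half := ((p ^ s).-1./2).

Definition alpha : F := 'qX.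

Definition coords (x : F) : 'rV['F_p]_s := poly_rV (x : {poly %/ pi}).
Definition of_coords (v : 'rV['F_p]_s) : F := in_qpoly pi (rVpoly v).

Definition dotp (x y : F) : 'F_p := \sum_(i < s) coords x 0 i * coords y 0 i.

Section Frame.

Variables (C : fieldType) (zeta : C).

Definition paley (y : F) : 'cV[C]_half :=
  \col_(i < half) zeta ^+ (dotp (alpha ^+ (2 * i)) y : nat).

Definition modulation (b : F) : 'M[C]_half := diag_mx (paley b)^T.

Definition translation : 'M[C]_half :=
  \matrix_(i, j) (i == j.+1 %% half :> nat)%N%:R.

Definition galois_perm : 'M[C]_half :=
  \matrix_(i, j) (i == (p * j) %% half :> nat)%N%:R.

Definition paley_group : set 'M[C]_half :=
  [set U | exists (b : F) (l k : nat), [/\ (l < half)%N, (k < s)%N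
     & U = modulation b *m translation ^+ l *m galois_perm ^+ k]].

End Frame.

(* The iterated semidirect product.  [Zp n] is the cyclic group of order n for
   every n > 0, although the type 'Z_1 has two elements.  [sdprod_by] is built on
   right actions; since the acting groups are abelian, the right actions below
   are also left actions, and exchanging the two conventions amounts to inverting
   the elements of the acting group. *)
Section Semidirect.

Hypothesis p_pr : prime p.
Hypothesis size_pi : size pi = s.+1.
Hypothesis q_gt3 : (3 < p ^ s)%N.
Hypothesis q_mod4 : (p ^ s = 3 %[mod 4])%N.
Hypothesis alpha_gen : primitive_element alpha.

Lemma card_Fq : #|F| = (p ^ s)%N.
Proof. by rewrite card_qfpoly card_Fp // size_pi. Qed.

Lemma half_gt1 : (1 < half)%N.
Proof. by move: q_mod4 q_gt3; case: (p ^ s)%N => [|[|[|[|[|[]]]]]]. Qed.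

Lemma halfE : (2 * half = (p ^ s).-1)%N.
Proof.
have q_odd : odd (p ^ s).
  by rewrite (divn_eq (p ^ s) 4) q_mod4 oddD oddM andbF.
rewrite mul2n -[RHS]odd_double_half; move: q_odd q_gt3.
by case: (p ^ s)%N => //= q; case: odd.
Qed.

Lemma alpha_neq0 : alpha != 0.
Proof.
apply/eqP => a0; have : (2 < #|F|)%N by rewrite card_Fq ltnW.
apply/negP; rewrite -leqNgt -(card_bool).
rewrite -(card_codom (f := fun b : bool => if b then 1 : F else 0)); last first.
  by move=> [] [] // /eqP; rewrite ?(eq_sym 0) oner_eq0.
apply/subset_leq_card/fintype.subsetP => x _; apply/codomP.
have [->|/alpha_gen[[|k] ->]] := eqVneq x 0; first by exists false.
  by exists true.
by exists false; rewrite a0 expr0n.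
Qed.

Lemma alpha_half : alpha ^+ (2 * half) = 1.
Proof.
apply: (mulfI alpha_neq0); rewrite -exprS halfE prednK ?expn_gt0 ?prime_gt0 //.
by rewrite -card_Fq expf_card mulr1.
Qed.

Lemma alpha_mod l : alpha ^+ (2 * (l %% half)%N) = alpha ^+ (2 * l).
Proof.
rewrite [in RHS](divn_eq l half) mulnDr exprD.
have -> : (2 * (l %/ half * half) = 2 * half * (l %/ half))%N.
  by rewrite mulnCA mulnC.
by rewrite (exprM _ (2 * half)) alpha_half expr1n mul1r.
Qed.

Lemma coordsK : cancel coords of_coords.
Proof.
move=> x; have mkE := mk_monicE mi.
have szx : (size (x : {poly %/ pi}) <= s)%N.
  rewrite -ltnS; apply: leq_trans (size_mk_monic _) _.
  by rewrite mkE size_pi.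
rewrite /coords /of_coords poly_rV_K //; apply/val_inj.
by apply: in_qpoly_small; apply: size_mk_monic.
Qed.

Lemma of_coordsK : cancel of_coords coords.
Proof.
move=> v; rewrite /coords /of_coords in_qpoly_small ?rVpolyK //.
by rewrite mk_monicE // size_pi ltnS size_poly.
Qed.

Lemma coordsD x y : coords (x + y) = coords x + coords y.
Proof. exact: raddfD. Qed.

Lemma of_coordsD v w : of_coords (v + w) = of_coords v + of_coords w.
Proof. by rewrite /of_coords raddfD /= in_qpolyD. Qed.

(* l in Z_((q-1)/2) acts as multiplication by the square alpha ^+ (2 * l). *)
Definition qr_act (v : 'rV['F_p]_s) (l : 'Z_half) : 'rV['F_p]_s :=
  coords (alpha ^+ (2 * l) * of_coords v).

Lemma qr_is_action : is_action (Zp half) qr_act.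
Proof.
split=> [l v w /(can_inj coordsK)/mulfI vw|v l m _ _].
  by apply: (can_inj of_coordsK); apply: vw; rewrite expf_neq0 ?alpha_neq0.
rewrite /qr_act coordsK mulrA -exprD -mulnDr /=.
by rewrite [X in (_ %% X)%N]Zp_cast ?half_gt1 // alpha_mod addnC.
Qed.
Definition qr_action := Action qr_is_action.

Lemma qr_is_groupAction :
  is_groupAction [set: 'rV['F_p]_s] qr_action.
Proof.
move=> l Dl; rewrite inE; apply/andP; split; first exact/fintype.subsetP.
apply/morphicP=> v w _ _; rewrite !actpermE /= /qr_act.
by rewrite of_coordsD mulrDr coordsD.
Qed.
Definition qr_groupAction : groupAction (Zp half) [set: 'rV['F_p]_s] :=
  GroupAction qr_is_groupAction.

Definition sd_inner := sdprod_by qr_groupAction.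

(* k in Z_s acts as x |-> x ^+ (p ^ k) on F, hence on the factor Z_((q-1)/2) as
   multiplication by p ^ k, written as a power in [gal_act]. *)
Lemma gal_act_subproof (u : sd_inner) (k : nat) :
  ((u.1 ^+ (p ^ k))%g, coords (of_coords u.2 ^+ (p ^ k)))
    \in finset.setX (Zp half) [set: 'rV['F_p]_s].
Proof. by case: u => [[l v]] /= /setXP[Dl _]; rewrite !inE andbT; apply: groupX. Qed.

Definition gal_act (u : sd_inner) (k : 'Z_s) : sd_inner :=
  SdPair qr_groupAction (gal_act_subproof u k).

Lemma val_qr_exp (l : 'Z_half) n : ((l ^+ n)%g = (l * n) %% half :> nat)%N.
Proof. by rewrite zmodXgE Zp_mulrn /= [X in (_ %% X)%N]Zp_cast ?half_gt1. Qed.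

Lemma pchar_Fq : p \in [pchar F].
Proof. by rewrite pchar_lalg pchar_Fp. Qed.

Lemma frobD k (x y : F) : (x + y) ^+ (p ^ k) = x ^+ (p ^ k) + y ^+ (p ^ k).
Proof. by apply: exprDn_pchar; rewrite pnatX pnatE // pchar_Fq. Qed.

Lemma frob_inj k : injective (fun x : F => x ^+ (p ^ k)).
Proof.
move=> x y /= xy; apply/eqP; rewrite -subr_eq0.
have : (x - y) ^+ (p ^ k) == 0.
  by rewrite -(addrK (y ^+ (p ^ k)) ((x - y) ^+ (p ^ k))) -frobD subrK xy subrr.
by rewrite expf_eq0 => /andP[].
Qed.

Lemma qr_exp_inj k :
  {in Zp half &, injective (fun l : 'Z_half => (l ^+ (p ^ k))%g)}.
Proof.
apply: (can_in_inj (expgK _)); rewrite card_Zp ?(ltnW half_gt1) //.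
apply: coprimeXr; rewrite coprime_sym prime_coprime //.
have s_gt0 : (0 < s)%N by move: q_gt3; case: (s).
apply/negP => p_half; have : (p %| (p ^ s).-1)%N by rewrite -halfE dvdn_mull.
rewrite -subn1 dvdn_subr ?expn_gt0 ?prime_gt0 ?dvdn_exp // dvdn1 => /eqP p1.
by move: p_pr; rewrite p1.
Qed.

Lemma pow_mod T (f : T -> nat -> T) x k :
    (forall y m n, f (f y m) n = f y (m * n)%N) -> (forall y, f y (p ^ s)%N = y) ->
  f x (p ^ (k %% s))%N = f x (p ^ k)%N.
Proof.
move=> fM fs; rewrite [in RHS](divn_eq k s) expnD -fM; congr (f _ _).
elim: (k %/ s)%N => [|n IHn]; first by rewrite mul0n expn0 -{2}(fs x) fM muln1 fs.
by rewrite mulSn expnD -fM fs.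
Qed.

Lemma frob_s (x : F) : x ^+ (p ^ s) = x.
Proof. by rewrite -card_Fq expf_card. Qed.

Lemma Zp_half_full (l : 'Z_half) : l \in Zp half.
Proof. by rewrite /Zp half_gt1 inE. Qed.

Lemma qr_exp_s (l : 'Z_half) : (l ^+ (p ^ s))%g = l.
Proof.
have lh : (l ^+ half)%g = 1%g.
  by have := expg_cardG (Zp_half_full l); rewrite card_Zp ?(ltnW half_gt1).
have qE : (p ^ s = (half * 2).+1)%N.
  by rewrite mulnC halfE prednK // (ltnW (ltnW (ltnW q_gt3))).
by rewrite [X in (l ^+ X)%g]qE expgS expgM lh expg1n mulg1.
Qed.

Lemma gal_is_action : is_action (Zp s) gal_act.
Proof.
split=> [k [[l v] luv] [[m w] mw]|u k m Dk Dm].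
  move=> [/(qr_exp_inj (Zp_half_full _) (Zp_half_full _)) lm].
  move=> /(can_inj coordsK)/frob_inj/(can_inj of_coordsK) vw.
  by apply: val_inj; rewrite /= lm vw.
apply: val_inj => /=; rewrite coordsK -expgM -exprM -expnD.
have -> : ((k + m) %% (Zp_trunc s).+2 = (k + m) %% s)%N.
  have [s_gt1|s_le1] := ltnP 1 s; first by congr modn; exact: Zp_cast.
  move: Dk Dm; rewrite /Zp ltnNge s_le1 /= !inE => /eqP-> /eqP->.
  by rewrite !mod0n.
congr pair.
  apply: (pow_mod (f := fun (l : 'Z_half) n => (l ^+ n)%g)) => [l i j|l].
    by rewrite expgM.
  exact: qr_exp_s.
congr coords; apply: (pow_mod (f := fun (x : F) n => x ^+ n)) => [x i j|x].
  by rewrite exprM.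
exact: frob_s.
Qed.
Definition gal_action := Action gal_is_action.

Lemma gal_is_groupAction : is_groupAction [set: sd_inner] gal_action.
Proof.
move=> k Dk; rewrite inE; apply/andP; split; first exact/fintype.subsetP.
apply/morphicP=> -[[l v] lv] [[m w] mw] _ _; rewrite !actpermE /=.
apply: val_inj => /=; congr pair.
  by rewrite expgMn //; exact: zmod_mulgC.
rewrite /qr_act /= !coordsK.
rewrite -[RHS]coordsD; congr coords.
rewrite [of_coords _]of_coordsD coordsK frobD exprMn; congr (_ * _ + _).
by rewrite val_qr_exp alpha_mod -exprM mulnA.
Qed.
Definition gal_groupAction : groupAction (Zp s) [set: sd_inner] :=
  GroupAction gal_is_groupAction.

Definition paley_semidirect : finGroupType := sdprod_by gal_groupAction.

End Semidirect.
End Paley.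

Arguments paley {p} s [pi] mi [C] zeta y.
Arguments paley_group {p} s [pi] mi [C] zeta.

(* Main.v *)
Require Import Defs.
From mathcomp Require Import all_boot all_order all_fingroup all_algebra.
From mathcomp Require Import all_solvable all_field.
From mathcomp Require Import all_classical reals complex ring zify.
Set Implicit Arguments.
Unset Strict Implicit.
Unset Printing Implicit Defensive.
Import GroupScope Order.TTheory GRing.Theory Num.Theory FinRing.Theory.
Local Open Scope ring_scope.
Local Open Scope sesquilinear_scope.

(** Write q = 2h + 1 with h odd, so that x ^+ h is the quadratic character and
    -1 is not a square: exactly one of y - x, x - y is a square for x <> y, and
    the squares define the Paley tournament on F.

    The dot product of coordinate vectors becomes a field-invariant pairing
    after relabelling the columns.  For an additive form tau : F -> 'F_p that
    is invariant under Frobenius (a coordinate of the absolute trace), the map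
    [dual] satisfies dotp x (dual c) = tau (x * c).  So, up to the permutation
    [dual] of the index set, the frame vectors are phi_c = (psi (u * c)) for u
    in the squares, where psi = zeta ^+ tau is a Frobenius-invariant additive
    character.  In this form M, T and Pi act by c |-> c + b, by
    c |-> alpha ^- 2 * c and by c |-> c ^+ p; hence the words in them induce
    exactly the maps m * x ^+ (p ^ k) + b with m a square.

    The Gram matrix of phi has entries gamma (y - x) with gamma a Gauss period,
    which takes the value h at 0, one value eta_1 at the squares and another
    eta_0 at the nonsquares, where eta_0 + eta_1 = -1 and
    2 * eta_0 * eta_1 = h + 1.

    A line automorphism preserves the triple products of the Gram matrix.  For
    q > 3 the monomials eta_1 ^ j eta_0 ^ (3 - j), j <= 3, are pairwise
    distinct, so it preserves the number of arcs of x -> y -> z -> x in the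
    tournament; summing over z recovers the arc x -> y ([Sym_l_diff_char]).
    It is thus an automorphism of the Paley tournament, and a theorem of
    Carlitz ([diff_char_affine]) says that these are the maps m * x ^ sigma + b
    with m a square.  This closes the chain

      AGammaL_QR <= Sym_v <= Sym_l <= AGammaL_QR

    (after conjugation by [dual]).  The vectors form a tight frame, so a matrix
    that permutes them is unitary and is determined by its permutation: vector
    automorphisms, elements of the symmetry group and words in M, T, Pi
    correspond to each other.

    Carlitz's theorem is proved as follows.  Power sums express a map f with
    (f x - f y) ^+ h = (x - y) ^+ h as a polynomial of degree at most h.  If
    f 0 = 0, then x |-> 1 / f (1 / x) has the same property, and the product of
    the first polynomial with the reversal of the second is 'X^h; so f is a
    monomial.  Applied to f (x + 1) - f 1 as well, this gives additivity.

    Affine maps with square slope are transitive on the arcs of the tournament,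
    which gives 2-homogeneity; no arc can be reversed, which excludes
    2-transitivity. *)

(** * The quadratic character of a field of order 2h + 1, h odd *)
Section QuadraticCharacter.

Variables (F : finFieldType) (h : nat).
Hypotheses (card_F : #|F| = h.*2.+1) (h_odd : odd h).

Let h_gt0 : (0 < h)%N. Proof. by case: (h) h_odd. Qed.

Lemma expf_half2 (x : F) : x != 0 -> x ^+ h.*2 = 1.
Proof.
move=> x0; apply: (mulfI x0); rewrite -exprS mulr1 -[RHS]expf_card.
by rewrite card_F.
Qed.

Lemma natr_half2 : h.*2%:R = -1 :> F.
Proof.
apply/eqP; rewrite -addr_eq0 natr1 -card_F -cardsT -zmodXgE.
by rewrite (expg_cardG (G := [set: F]%G)) ?inE.
Qed.

Lemma two_neq0 : 2 != 0 :> F.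
Proof.
by apply/eqP => two0; have /eqP := natr_half2;
  rewrite -muln2 natrM two0 mulr0 eq_sym oppr_eq0 oner_eq0.
Qed.

Lemma expf_halfP (x : F) : x != 0 -> (x ^+ h == 1) || (x ^+ h == -1).
Proof. by move=> x0; rewrite -sqrf_eq1 -exprM muln2 expf_half2. Qed.

Lemma oppr1_half : (-1) ^+ h = -1 :> F.
Proof. by rewrite -signr_odd h_odd expr1. Qed.

Lemma oppr1_neq1 : -1 != 1 :> F.
Proof. by rewrite eq_sym -addr_eq0 (_ : 1 + 1 = 2) // two_neq0. Qed.

(** As h is odd, x ^+ h = 1 exhibits x = x ^+ h.+1 as an explicit square. *)
Lemma QRE (x : F) : (x \in QR F) = (x ^+ h == 1).
Proof.
apply/imsetP/eqP => [[y]|xh].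
  by rewrite inE => y0 ->; rewrite -exprM mul2n expf_half2.
exists (x ^+ h.+1./2).
  rewrite inE expf_neq0 //; apply/eqP => x0; move/eqP: xh.
  by rewrite x0 expr0n eqn0Ngt h_gt0 /= eq_sym oner_eq0.
by rewrite -exprM muln2 even_halfK ?oddS ?h_odd // exprS xh mulr1.
Qed.

Lemma QR_neq0 (x : F) : x \in QR F -> x != 0.
Proof.
rewrite QRE; apply: contraTneq => ->.
by rewrite expr0n eqn0Ngt h_gt0 eq_sym oner_eq0.
Qed.

Lemma QRN (x : F) : x != 0 -> (- x \in QR F) = (x \notin QR F).
Proof.
move=> x0; rewrite !QRE exprNn oppr1_half mulN1r.
have /orP[/eqP->|/eqP->] := expf_halfP x0; rewrite ?opprK ?eqxx.
  by rewrite (negbTE oppr1_neq1).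
by rewrite oppr1_neq1.
Qed.

(** The h-th power takes the three values 0, 1, -1, told apart by these two
    tests. *)
Lemma QR_half_inj (x y : F) : (x == 0) = (y == 0) ->
  (x \in QR F) = (y \in QR F) -> x ^+ h = y ^+ h.
Proof.
have [->|x0] := eqVneq x 0; have [->|y0] := eqVneq y 0 => // _.
rewrite !QRE; have /orP[/eqP->|/eqP->] := expf_halfP x0;
have /orP[/eqP->|/eqP->] := expf_halfP y0 => //; rewrite ?eqxx ?(negbTE oppr1_neq1) //.
Qed.

End QuadraticCharacter.

(** * Carlitz's theorem on maps preserving the quadratic character of differences *)
Section Carlitz.

Variables (F : finFieldType) (h : nat).
Hypotheses (card_F : #|F| = h.*2.+1) (h_odd : odd h).

Let h_gt0 : (0 < h)%N. Proof. by case: (h) h_odd. Qed.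

Lemma poly_eq_fun (P Q : {poly F}) (A : pred F) :
  (size P <= #|A|)%N -> (size Q <= #|A|)%N ->
  {in A, forall x, P.[x] = Q.[x]} -> P = Q.
Proof.
move=> sP sQ PQ; apply/eqP; rewrite -subr_eq0; apply/negPn/negP => PQ0.
have := max_poly_roots PQ0 _ (enum_uniq A); rewrite -cardE.
have -> : all (root (P - Q)) (enum A).
  by apply/allP => x; rewrite mem_enum => /PQ xA; rewrite rootE !hornerE xA subrr.
move=> /(_ isT); rewrite ltnNge (leq_trans (size_polyD _ _)) //.
by rewrite size_polyN geq_max sP.
Qed.

Lemma card_neq0 : #|[pred x : F | x != 0]| = h.*2.
Proof. by have := cardC1 (0 : F); rewrite card_F. Qed.

Lemma sum_expf_small k : (0 < k < h.*2)%N -> \sum_(x : F) x ^+ k = 0.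
Proof.
move=> /andP[k0 kh]; set S := (LHS).
have [g g0 gk] : exists2 g : F, g != 0 & g ^+ k != 1.
  apply/exists_inP; rewrite -negb_forall_in; apply/negP => /forall_inP H.
  have E : 'X^k = 1 :> {poly F}.
    apply: (@poly_eq_fun _ _ [pred x | x != 0]); rewrite ?card_neq0 ?size_polyXn //.
      by rewrite size_poly1 double_gt0.
    by move=> x /H/eqP xk; rewrite hornerXn hornerC.
  by have := size_polyXn F k; rewrite E size_poly1 => -[k0']; rewrite -k0' in k0.
have : (g ^+ k - 1) * S = 0.
  rewrite mulrBl mul1r mulr_sumr; apply/eqP; rewrite subr_eq0; apply/eqP.
  rewrite [RHS](reindex_inj (mulfI g0)); apply: eq_bigr => x _.
  by rewrite exprMn.
by move/eqP; rewrite mulf_eq0 subr_eq0 (negbTE gk) => /eqP.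
Qed.

Lemma sum_expf_half2 : \sum_(x : F) x ^+ h.*2 = -1.
Proof.
rewrite (bigD1 0) //= expr0n double_eq0 eqn0Ngt h_gt0 add0r.
rewrite (eq_bigr (fun _ => 1)) => [|x /(expf_half2 card_F) //].
by rewrite sumr_const card_neq0 (natr_half2 card_F).
Qed.

Definition diff_char_preserving (f : F -> F) : Prop :=
  forall x y, (f x - f y) ^+ h = (x - y) ^+ h.

Lemma diff_char_inj f : diff_char_preserving f -> injective f.
Proof.
move=> fP x y fxy; have /eqP := fP x y; rewrite fxy subrr expr0n eqn0Ngt h_gt0.
by rewrite eq_sym expf_eq0 h_gt0 subr_eq0 => /eqP.
Qed.

(** In carlitz_poly f the weight f b ^+ h.+1 is the power whose product with
    f b ^+ h.-1 has the nonvanishing power sum, of exponent 2h; the factor 2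
    normalises the binomial coefficient h = -1/2. *)
Definition carlitz_poly (f : F -> F) : {poly F} :=
  \sum_b (2 * f b ^+ h.+1) *: ('X - b%:P) ^+ h.

Lemma size_carlitz_poly f : (size (carlitz_poly f) <= h.+1)%N.
Proof.
apply: leq_trans (size_sum _ _ _) _; apply/bigmax_leqP => b _.
by apply: leq_trans (size_scale_leq _ _) _; rewrite size_exp_XsubC.
Qed.

(** Replace x - b by f x - f b, sum over the values y = f b, and expand
    (f x - y) ^+ h.  In the coefficient of f x ^+ (h - j) stands the power sum
    of exponent h + 1 + j, between h + 1 and 2h + 1 = q: it vanishes unless
    h + 1 + j = 2h, which leaves the linear term in f x. *)
Lemma carlitz_polyE f : diff_char_preserving f ->
  forall x, (carlitz_poly f).[x] = f x.
Proof.
move=> fP x; rewrite horner_sum.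
under eq_bigr do rewrite hornerZ horner_exp hornerXsubC -fP -mulrA.
rewrite -mulr_sumr.
have f_bij := injF_bij (diff_char_inj fP).
rewrite -(reindex f (P := predT) (F := fun y => y ^+ h.+1 * (f x - y) ^+ h)) /=;
  last exact: onW_bij.
under eq_bigr do rewrite exprBn mulr_sumr.
rewrite exchange_big /=.
have sum_j (j : 'I_h.+1) :
    \sum_y y ^+ h.+1 * ((-1) ^+ j * f x ^+ (h - j) * y ^+ j *+ 'C(h, j)) =
    (-1) ^+ j * f x ^+ (h - j) *+ 'C(h, j) * \sum_(y : F) y ^+ (h.+1 + j).
  rewrite mulr_sumr; apply: eq_bigr => y _.
  by rewrite mulrnAr mulrCA -exprD mulrnAl.
rewrite (eq_bigr _ (fun j _ => sum_j j)).
have lt_h : (h.-1 < h.+1)%N by rewrite ltnS leq_pred.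
rewrite (bigD1 (Ordinal lt_h)) //= [X in _ + X]big1 ?addr0 => [|j jne].
  rewrite addSnnS prednK // addnn sum_expf_half2.
  have -> : (h - h.-1 = 1)%N by rewrite -{1}(prednK h_gt0) subSnn.
  have -> : 'C(h, h.-1) = h by rewrite -{1}(prednK h_gt0) binSn prednK.
  have -> : (-1) ^+ h.-1 = 1 :> F.
    by rewrite -signr_odd; move: h_odd h_gt0; case: (h) => //= n /negbTE->.
  rewrite mul1r mulrN1 expr1 mulrN mulr_natl -mulrnA muln2 -mulr_natl -mulNr.
  by rewrite (natr_half2 card_F) opprK mul1r.
have [jh|] := ltnP j h.-1.
  rewrite sum_expf_small ?mulr0 // //= -addnn addSn -addnS ltn_add2l.
  by rewrite -{2}(prednK h_gt0) ltnS.
rewrite leq_eqVlt => /predU1P[jE|]; first by rewrite -val_eqE /= jE eqxx in jne.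
rewrite prednK // => hj; have -> : j = h :> nat.
  by apply/eqP; rewrite eqn_leq hj -ltnS ltn_ord.
rewrite (eq_bigr (fun y => y ^+ 1)) => [|y _].
  by rewrite sum_expf_small ?mulr0 //= -[1%N]/(0.*2.+1) ltn_Sdouble.
by rewrite addSn addnn -card_F expf_card expr1.
Qed.

Lemma dvdp_Xn_monomial (P : {poly F}) n :
  P %| 'X^n -> exists c e, P = c *: 'X^e.
Proof.
rewrite -['X]subr0 => /dvdp_exp_XsubCP[e _ /eqpf_eq[c _ ->]].
by exists c, e; rewrite subr0.
Qed.

Lemma invfB_half (a b : F) : a != 0 -> b != 0 ->
  (a^-1 - b^-1) ^+ h = (b - a) ^+ h / (a ^+ h * b ^+ h).
Proof.
move=> a0 b0; rewrite -exprMn -exprVn -exprMn; congr (_ ^+ _).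
by rewrite mulrBl invfM mulrCA divff // mulr1 mulrA divff // mul1r.
Qed.

(** 1/a - 1/b = (b - a) / (a b), and f changes the character of neither the
    numerator nor the denominator. *)
Lemma diff_char_inv f : diff_char_preserving f -> f 0 = 0 ->
  diff_char_preserving (fun x => (f x^-1)^-1).
Proof.
move=> fP f0.
have fh x : f x ^+ h = x ^+ h by have := fP x 0; rewrite f0 !subr0.
have gh x : (f x^-1)^-1 ^+ h = x ^+ h by rewrite exprVn fh exprVn invrK.
have f_eq0 x : (f x == 0) = (x == 0).
  by rewrite -[in RHS](inj_eq (diff_char_inj fP)) f0.
move=> x y; have [->|x0] := eqVneq x 0.
  by rewrite invr0 f0 invr0 !sub0r exprNn gh -exprNn.
have [->|y0] := eqVneq y 0; first by rewrite invr0 f0 invr0 !subr0 gh.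
rewrite invfB_half ?f_eq0 ?invr_eq0 // fP !fh -invfB_half ?invr_eq0 //.
by rewrite !invrK.
Qed.

(** Both f and g x = 1 / f (1 / x) are given by polynomials P, Q of degree at
    most h.  At x != 0, P.[x] * Q.[1 / x] = 1; multiplying by x ^+ h turns this
    into an equality of polynomials of degree below the number 2h of nonzero
    points, so P divides 'X^h. *)
Lemma diff_char_monomial f : diff_char_preserving f -> f 0 = 0 ->
  exists c e, (e <= h)%N /\ forall x, f x = c * x ^+ e.
Proof.
move=> fP f0; pose g x := (f x^-1)^-1.
have gP : diff_char_preserving g by exact: diff_char_inv.
pose P := carlitz_poly f; pose Q := carlitz_poly g.
pose Qr := \sum_(i < h.+1) Q`_i *: 'X^(h - i).
(* The degree of the reversal drops below h because g 0 = 0, which is what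
   keeps deg (P * Qr) below 2h. *)
have Q0 : Q`_0 = 0 by rewrite -horner_coef0 carlitz_polyE // /g invr0 f0 invr0.
have sQr : (size Qr <= h)%N.
  apply: leq_trans (size_sum _ _ _) _; apply/bigmax_leqP => -[[|i] /= ih] _.
    by rewrite Q0 scale0r size_poly0.
  apply: leq_trans (size_scale_leq _ _) _; rewrite size_polyXn.
  by rewrite ltn_subLR ?addSn ?ltnS ?leq_addl // -ltnS.
have QrE x : x != 0 -> Qr.[x] = x ^+ h * (f x)^-1.
  move=> x0; have <- : Q.[x^-1] = (f x)^-1 by rewrite carlitz_polyE // /g invrK.
  rewrite (horner_coef_wide _ (size_carlitz_poly g)) horner_sum mulr_sumr.
  apply: eq_bigr => i _; rewrite hornerZ hornerXn mulrCA exprVn; congr (_ * _).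
  by rewrite expfB_cond // (negbTE x0) add0n -ltnS ltn_ord.
have PQr : P * Qr = 'X^h.
  apply: (@poly_eq_fun _ _ [pred x | x != 0]); rewrite ?card_neq0.
  - apply: leq_trans (size_polyMleq _ _) _.
    rewrite -subn1 leq_subLR -addnn addnA add1n leq_add //.
    exact: size_carlitz_poly.
  - by rewrite size_polyXn -addnn -addn1 leq_add2l.
  move=> x /= x0; rewrite hornerM hornerXn QrE // carlitz_polyE // mulrCA divff ?mulr1 //.
  by apply: contra x0 => /eqP fx0; apply/eqP/(diff_char_inj fP); rewrite fx0.
have [c [e PE]] : exists c e, P = c *: 'X^e.
  by apply: (@dvdp_Xn_monomial _ h); rewrite -PQr dvdp_mulr.
have fE x : f x = c * x ^+ e by rewrite -carlitz_polyE // -/P PE hornerZ hornerXn.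
have c0 : c != 0.
  apply/eqP => c0; have := oner_neq0 F; rewrite -[1 == 0](inj_eq (diff_char_inj fP)).
  by rewrite !fE c0 !mul0r eqxx.
exists c, e; split=> //; rewrite -ltnS -(size_polyXn F e) -(size_scale _ c0) -PE.
exact: size_carlitz_poly.
Qed.

(** (x + 1) ^+ e - 1 also preserves the character and fixes 0, so it is a
    monomial; comparing degrees and leading coefficients, it is x ^+ e. *)
Lemma diff_char_frobenius e : (e <= h)%N ->
  diff_char_preserving (fun x => x ^+ e) ->
  forall x y : F, (x + y) ^+ e = x ^+ e + y ^+ e.
Proof.
move=> eh eP.
have e_gt0 : (0 < e)%N.
  rewrite lt0n; apply/eqP => e0; have /eqP : 0 = 1 :> F.
    by apply: (diff_char_inj eP); rewrite e0.
  by rewrite eq_sym oner_eq0.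
have gP : diff_char_preserving (fun x => (x + 1) ^+ e - 1).
  by move=> x y; rewrite opprB addrA subrK eP opprD addrACA subrr addr0.
have [|c [e' [e'h gE]]] := diff_char_monomial gP; first by rewrite add0r expr1n subrr.
have sX1 : size (('X + 1%:P) ^+ e : {poly F}) = e.+1.
  by rewrite -[1%:P]opprK -polyCN size_exp_XsubC.
have polyE : ('X + 1%:P) ^+ e - 1%:P = c *: 'X^e' :> {poly F}.
  have lt_card n : (n <= h)%N -> (n.+1 <= #|F|)%N.
    by rewrite card_F ltnS -addnn => /leq_trans; apply; exact: leq_addr.
  apply: (@poly_eq_fun _ _ predT).
  - rewrite (leq_trans (size_polyD _ _)) // sX1 size_polyN geq_max lt_card //.
    by rewrite (leq_trans (size_polyC_leq1 _)) ?lt_card.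
  - by rewrite (leq_trans (size_scale_leq _ _)) // size_polyXn lt_card.
  by move=> x _; rewrite !hornerE gE.
have size_lhs : size (('X + 1%:P) ^+ e - 1%:P : {poly F}) = e.+1.
  by rewrite size_polyDl sX1 // size_polyN (leq_ltn_trans (size_polyC_leq1 _)).
have c0 : c != 0.
  by apply/eqP => c0; move: size_lhs; rewrite polyE c0 scale0r size_poly0.
have ee' : e' = e by move: size_lhs; rewrite polyE size_scale // size_polyXn => -[].
have c1 : c = 1.
  have /(congr1 lead_coef) := polyE; rewrite lead_coefZ lead_coefXn mulr1 => <-.
  rewrite lead_coefDl ?size_polyN ?sX1 ?(leq_ltn_trans (size_polyC_leq1 _)) //.
  by rewrite -[1%:P]opprK -polyCN lead_coef_exp lead_coefXsubC expr1n.
have X1 (x : F) : (x + 1) ^+ e = x ^+ e + 1.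
  by apply/eqP; rewrite -subr_eq gE c1 ee' mul1r.
move=> x y; have [->|y0] := eqVneq y 0.
  by rewrite addr0 expr0n eqn0Ngt e_gt0 addr0.
by rewrite -{1}(divfK y0 x) -{3}[y]mul1r -mulrDl exprMn X1 mulrDl mul1r -exprMn divfK.
Qed.

(** Carlitz's theorem: normalise to f 0 = 0 and f 1 = 1. *)
Lemma diff_char_affine f : diff_char_preserving f ->
  exists m b (s : {perm F}),
    [/\ m \in QR F, s \in field_aut_set F & forall x, f x = m * s x + b].
Proof.
move=> fP; pose b := f 0; pose m := f 1 - b; pose g x := m^-1 * (f x - b).
have mQR : m \in QR F by rewrite (QRE card_F h_odd) fP subr0 expr1n.
have m0 : m != 0 := QR_neq0 card_F h_odd mQR.
have gP : diff_char_preserving g.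
  move=> x y; rewrite -mulrBr opprB addrA subrK exprMn fP exprVn.
  by move: mQR; rewrite (QRE card_F h_odd) => /eqP->; rewrite invr1 mul1r.
have [|c [e [eh gE]]] := diff_char_monomial gP; first by rewrite /g subrr mulr0.
have c1 : c = 1 by have := gE 1; rewrite expr1n mulr1 /g mulVf.
have {}gE x : g x = x ^+ e by rewrite gE c1 mul1r.
have eP : diff_char_preserving (fun x => x ^+ e) by move=> x y; rewrite -!gE gP.
exists m, b, (perm (diff_char_inj gP)); split=> //; last first.
  by move=> x; rewrite permE mulrA divff // mul1r subrK.
apply/field_autP; split=> x y; rewrite !permE !gE ?exprMn //.
exact: diff_char_frobenius.
Qed.
End Carlitz.

(** * Squares as the even powers of a primitive element *)
Section SquarePowers.

Variables (F : finFieldType) (h : nat) (a : F).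
Hypotheses (card_F : #|F| = h.*2.+1) (h_odd : odd h).
Hypothesis a_gen : primitive_element a.

Let h_gt0 : (0 < h)%N. Proof. by case: (h) h_odd. Qed.

Lemma primitive_element_neq0 : a != 0.
Proof.
apply/eqP => a0; have [|[|k] Ek] := a_gen (x := -1); first by rewrite oppr_eq0 oner_eq0.
  by have /eqP := oppr1_neq1 card_F; apply.
by move/eqP: Ek; rewrite a0 expr0n oppr_eq0 oner_eq0.
Qed.

Lemma card_QR : #|QR F| = h.
Proof.
have QR0 : 0 \notin QR F by apply/negP => /(QR_neq0 card_F h_odd)/eqP.
have cardN : #|[set x : F | (x != 0) && (x \notin QR F)]| = #|QR F|.
  rewrite -(card_imset (mem (QR F)) (@oppr_inj F)); apply: eq_card => x.
  rewrite inE; apply/andP/imsetP => [[x0 xN]|[y yQ ->]].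
    by exists (- x); rewrite ?opprK // (QRN card_F).
  have y0 := QR_neq0 card_F h_odd yQ.
  by rewrite oppr_eq0 (QRN card_F) ?yQ.
have : (#|QR F| + #|QR F| = h.*2)%N.
  rewrite -{2}cardN -[RHS](card_neq0 card_F).
  rewrite -(cardID (mem (QR F)) [pred x | x != 0]); congr (_ + _)%N; apply: eq_card => x.
    rewrite !inE; have [->|//] := eqVneq x 0; exact: negbTE.
  by rewrite !inE andbC.
by rewrite addnn => /double_inj.
Qed.

Lemma imset_sqr_pow : [set a ^+ (2 * i) | i : 'I_h] = QR F.
Proof.
have a0 := primitive_element_neq0; apply/setP => x; apply/imsetP/idP => [[i _ ->]|].
  by rewrite mulnC exprM; apply: imset_f; rewrite inE expf_neq0.
case/imsetP=> y; rewrite inE => /a_gen[k ->] ->.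
exists (Ordinal (ltn_pmod k h_gt0)) => //=.
have E : (2 * (k %/ h * h) = h.*2 * (k %/ h))%N by rewrite -mul2n mulnCA mulnC.
rewrite -exprM mulnC {1}(divn_eq k h) mulnDr exprD E exprM.
by rewrite (expf_half2 card_F) // expr1n mul1r.
Qed.

Lemma sqr_pow_inj : injective (fun i : 'I_h => a ^+ (2 * i)).
Proof.
apply: in2T; apply/imset_injP.
by rewrite imset_sqr_pow card_QR card_ord.
Qed.

Lemma big_sqr_pow (V : nmodType) (f : F -> V) :
  \sum_(i < h) f (a ^+ (2 * i)) = \sum_(u in QR F) f u.
Proof.
rewrite -imset_sqr_pow big_imset //=; last by move=> i j _ _; apply: sqr_pow_inj.
Qed.

End SquarePowers.

(** * Quadratic Gauss periods of an additive character *)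
Section GaussPeriods.

Variables (F : finFieldType) (h : nat) (C : numClosedFieldType) (psi : F -> C).
Hypotheses (card_F : #|F| = h.*2.+1) (h_odd : odd h).
Hypothesis psi0 : psi 0 = 1.
Hypothesis psiD : forall x y, psi (x + y) = psi x * psi y.
Hypothesis psi_neq1 : exists x, psi x != 1.

Let h_gt0 : (0 < h)%N. Proof. by case: (h) h_odd. Qed.

Lemma sum_add_char t : \sum_x psi (x * t) = if t == 0 then #|F|%:R else 0.
Proof.
have [->|t0] := eqVneq t 0.
  by under eq_bigr do rewrite mulr0 psi0; rewrite sumr_const.
rewrite -(reindex_inj (mulIf t0) (P := predT) (F := psi)) /=.
have [x psix] := psi_neq1.
suff /eqP : (psi x - 1) * \sum_y psi y = 0.
  by rewrite mulf_eq0 subr_eq0 (negbTE psix) => /eqP.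
rewrite mulrBl mul1r mulr_sumr [X in _ - X](reindex_inj (addrI x)) /=.
by under [X in _ - X]eq_bigr do rewrite psiD; rewrite subrr.
Qed.

Definition gauss_period t : C := \sum_(u in QR F) psi (u * t).

Lemma gauss_period0 : gauss_period 0 = h%:R.
Proof.
rewrite /gauss_period; under eq_bigr do rewrite mulr0 psi0.
by rewrite sumr_const (card_QR card_F h_odd).
Qed.

Lemma gauss_period_QR t : t \in QR F -> gauss_period t = gauss_period 1.
Proof.
move=> tQ; have t0 := QR_neq0 card_F h_odd tQ.
rewrite /gauss_period [RHS](reindex_inj (mulIf t0)) /=.
apply: eq_big => u; last by rewrite mulr1.
by move: tQ; rewrite !(QRE card_F h_odd) exprMn => /eqP->; rewrite mulr1.
Qed.

Lemma gauss_period_nonQR t : t != 0 -> t \notin QR F ->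
  gauss_period t = gauss_period (-1).
Proof.
move=> t0 tN.
have NtQ : - t \in QR F by rewrite (QRN card_F).
rewrite /gauss_period [RHS](reindex_inj (mulIf (QR_neq0 card_F h_odd NtQ))) /=.
apply: eq_big => u; last by rewrite mulrN1 mulrN opprK.
by move: NtQ; rewrite !(QRE card_F h_odd) [(u * _) ^+ h]exprMn => /eqP->; rewrite mulr1.
Qed.

Lemma big_field_QR (f : F -> C) :
  \sum_x f x = f 0 + \sum_(u in QR F) f u + \sum_(u in QR F) f (- u).
Proof.
rewrite (bigD1 0) //= -addrA (bigID (mem (QR F))) /=; congr (_ + (_ + _)).
  apply: eq_bigl => x; rewrite andbC.
  by case: (boolP (x \in QR F)) => //= /(QR_neq0 card_F h_odd).
rewrite (reindex_inj oppr_inj) /=; apply: eq_bigl => x; rewrite oppr_eq0.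
have [->|x0] := eqVneq x 0; last by rewrite (QRN card_F) // negbK.
by apply/esym/negP => /(QR_neq0 card_F h_odd)/eqP.
Qed.

Lemma gauss_period_sum : gauss_period 1 + gauss_period (-1) = -1.
Proof.
have -> : gauss_period 1 = \sum_(u in QR F) psi u.
  by apply: eq_bigr => u _; rewrite mulr1.
have -> : gauss_period (-1) = \sum_(u in QR F) psi (- u).
  by apply: eq_bigr => u _; rewrite mulrN1.
apply/eqP; rewrite -addr_eq0 addrC addrA -{1}psi0 -big_field_QR.
apply/eqP; transitivity (\sum_x psi (x * 1)); last by rewrite sum_add_char oner_eq0.
by apply: eq_bigr => x _; rewrite mulr1.
Qed.

(** Orthogonality of the characters t |-> psi (u * t), u a square. *)
Lemma gauss_period_parseval :
  \sum_t gauss_period t * gauss_period (- t) = (h * h.*2.+1)%:R.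
Proof.
transitivity (\sum_(u in QR F) \sum_(v in QR F) \sum_t psi (t * (u - v))).
  under eq_bigr do rewrite big_distrlr /=.
  rewrite exchange_big; apply: eq_bigr => u _; rewrite exchange_big.
  apply: eq_bigr => v _; apply: eq_bigr => t _.
  by rewrite -psiD mulrN -mulrBl mulrC.
rewrite (eq_bigr (fun=> #|F|%:R)) => [|u uQ].
  by rewrite sumr_const (card_QR card_F h_odd) card_F -mulrnA mulnC.
rewrite (bigD1 u) //= subrr sum_add_char eqxx big1 ?addr0 // => v /andP[_ vu].
by rewrite sum_add_char subr_eq0 eq_sym (negbTE vu).
Qed.

(** In Parseval's identity the term at 0 is h ^ 2 and each of the 2h others is
    the product of the two periods. *)
Lemma gauss_period_prod :
  2 * (gauss_period 1 * gauss_period (-1)) = h.+1%:R.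
Proof.
set N := gauss_period 1 * _.
have := gauss_period_parseval; rewrite big_field_QR oppr0 gauss_period0.
have E u : u \in QR F -> gauss_period u = gauss_period 1 /\
   gauss_period (- u) = gauss_period (-1).
  move=> uQ; have u0 := QR_neq0 card_F h_odd uQ; rewrite gauss_period_QR //.
  by rewrite (gauss_period_nonQR (t := - u)) ?oppr_eq0 // (QRN card_F) ?uQ.
rewrite (eq_bigr (fun=> N)) => [|u /E[-> ->] //].
rewrite [X in _ + X = _ -> _](eq_bigr (fun=> N)) => [|u /E[E1 E2]]; last first.
  by rewrite opprK E1 E2 mulrC.
rewrite !sumr_const (card_QR card_F h_odd) -!(mulr_natr N).
have -> : (h * h.*2.+1 = h * h + h * h.+1)%N by rewrite -mulnDr -addnn addnS.
rewrite natrD !natrM -addrA => /addrI NE.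
have h0 : h%:R != 0 :> C by rewrite pnatr_eq0 -lt0n.
by apply: (mulfI h0); rewrite -NE; ring.
Qed.

Lemma gauss_period_neq : gauss_period 1 != gauss_period (-1).
Proof.
apply/eqP => E; have := gauss_period_sum; have := gauss_period_prod; rewrite -E.
set e := gauss_period 1 => prodE sumE.
have : 2 * (2 * (e * e)) = (e + e) ^+ 2 by ring.
rewrite prodE sumE sqrrN expr1n -natrM => /eqP.
by rewrite (eqr_nat _ _ 1) muln_eq1.
Qed.

(** With e, f the two periods, two of these monomials can only agree if e = f,
    e ^ 2 = f ^ 2 or e ^ 3 = f ^ 3.  As e + f = -1, the second case reduces to
    the first, and the third to e * f = 1, that is h = 1 and q = 3, which
    h > 1 excludes. *)
Lemma gauss_period_monomial_inj (j k : nat) : (1 < h)%N -> (j <= 3)%N -> (k <= 3)%N ->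
  gauss_period 1 ^+ j * gauss_period (-1) ^+ (3 - j) =
  gauss_period 1 ^+ k * gauss_period (-1) ^+ (3 - k) -> j = k.
Proof.
move=> h_gt1; wlog : j k / (j < k)%N.
  move=> W j3 k3 E; case: (ltngtP j k) => // jk; first exact: (W j k).
  exact/esym/(W k j).
have neq := gauss_period_neq; have sumE := gauss_period_sum.
have prodE := gauss_period_prod.
set e := gauss_period 1 in neq sumE prodE *.
set f := gauss_period (-1) in neq sumE prodE *.
have ef0 : e * f != 0.
  by apply/eqP => ef; move/eqP: prodE; rewrite ef mulr0 eq_sym pnatr_eq0.
have [e0 f0] : e != 0 /\ f != 0 by move: ef0; rewrite mulf_eq0 negb_or => /andP[].
have sqr_neq : e ^+ 2 != f ^+ 2.
  by rewrite -subr_eq0 subr_sqr sumE mulrN1 oppr_eq0 subr_eq0.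
have cube_neq : e ^+ 3 != f ^+ 3.
  rewrite -subr_eq0 (_ : _ - _ = (e - f) * ((e + f) ^+ 2 - e * f)); last by ring.
  rewrite mulf_neq0 ?subr_eq0 // sumE sqrrN expr1n eq_sym; apply/eqP => ef1.
  move/eqP: prodE; rewrite ef1 mulr1 eqr_nat => /eqP[h1].
  by rewrite -h1 in h_gt1.
case: j => [|[|[|[|//]]]]; case: k => [|[|[|[|//]]]] //= _ _ _ E.
- case/eqP: neq; apply: (mulIf (expf_neq0 2 f0)); move: E.
  by rewrite mul1r expr1 exprS.
- case/eqP: sqr_neq; apply: (mulIf f0); move: E.
  by rewrite mul1r expr1 -exprSr.
- by case/eqP: cube_neq; move: E; rewrite mul1r mulr1.
- case/eqP: neq; apply: (mulIf ef0); move: E.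
  by rewrite !expr1 !expr2 !mulrA => <-; rewrite [f * e]mulrC.
- case/eqP: sqr_neq; apply: (mulIf e0); move: E.
  by rewrite mulr1 expr1 exprSr [f ^+ 2 * e]mulrC => ->.
- case/eqP: neq; apply: (mulIf (expf_neq0 2 e0)); move: E.
  by rewrite mulr1 expr1 mulrC [in RHS]exprS => <-.
Qed.
End GaussPeriods.

(** * Line symmetries, vector symmetries and tight frames *)
Section FrameSymmetry.

Variables (C : numClosedFieldType) (J : finType) (d : nat) (Phi : J -> 'cV[C]_d).

Definition gram x y : C := ((Phi x)^t* *m Phi y) 0 0.

(** A triple product does not change when the vectors are multiplied by phases:
    it depends on their lines only, on which line automorphisms act. *)
Lemma mul_line_trace x y z : \tr (line Phi x *m line Phi y *m line Phi z) =
  gram x y * gram y z * gram z x.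
Proof.
have gramE u v : (Phi u)^t* *m Phi v = (gram u v)%:M by exact: mx11_scalar.
rewrite /line -!mulmxA [(Phi y)^t* *m _]mulmxA gramE mul_scalar_mx -!scalemxAr.
rewrite [(Phi x)^t* *m _]mulmxA gramE mul_scalar_mx -!scalemxAr mxtraceZ.
by rewrite mxtraceZ mxtrace_mulC gramE mxtrace_scalar mulr1n mulrA [gram y z * _]mulrC.
Qed.

Lemma Sym_l_gram s x y z : s \in Sym_l Phi ->
  gram (s x) (s y) * gram (s y) (s z) * gram (s z) (s x) =
  gram x y * gram y z * gram z x.
Proof.
rewrite !inE => -[U uU Us]; rewrite -!mul_line_trace -!Us.
have UU : U^t* *m U = 1%:M.
  by rewrite -{2}(trmxCK U); apply/unitarymxP; rewrite trmxC_unitary.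
have lineE j : U *m Phi j *m (Phi j)^t* *m U^t* = U *m line Phi j *m U^t*.
  by rewrite /line !mulmxA.
have conjM (A B : 'M[C]_d) : U *m A *m U^t* *m (U *m B *m U^t*) = U *m (A *m B) *m U^t*.
  by rewrite !mulmxA -(mulmxA _ _ U) UU mulmx1.
by rewrite !lineE !conjM mxtrace_mulC [U^t* *m _]mulmxA UU mul1mx.
Qed.

Lemma Sym_v_sub_Sym_l : Sym_v Phi \subset Sym_l Phi.
Proof.
apply/fintype.subsetP => s; rewrite !inE => -[U uU Us].
exists U => // j; by rewrite /line -Us trmx_mul map_mxM !mulmxA.
Qed.

Variable c : C.
Hypotheses (c_neq0 : c != 0).
Hypothesis tight : \sum_j line Phi j = c%:M.

(** For a tight frame with constant c, the only matrix that can map each Phi j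
    to Phi (f j). *)
Definition synthesis (f : J -> J) : 'M[C]_d :=
  c^-1 *: \sum_j Phi (f j) *m (Phi j)^t*.

Lemma vector_inducesE U s : vector_induces Phi U s -> U = synthesis s.
Proof.
move=> Us; have : U *m c%:M = \sum_j Phi (s j) *m (Phi j)^t*.
  by rewrite -tight mulmx_sumr; apply: eq_bigr => j _; rewrite mulmxA Us.
by rewrite mul_mx_scalar /synthesis => <-; rewrite scalerA mulVf // scale1r.
Qed.

(** Conjugation by U permutes the terms of the frame operator c%:M, so
    c U U^* = c. *)
Lemma vector_induces_unitary U s : vector_induces Phi U s -> U \is unitarymx.
Proof.
move=> Us; have : U *m c%:M *m U^t* = c%:M.
  rewrite -tight mulmx_sumr mulmx_suml [RHS](reindex_inj (@perm_inj _ s)).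
  apply: eq_bigr => j _; rewrite /line -Us trmx_mul map_mxM !mulmxA.
  by [].
rewrite mul_mx_scalar -scalemxAl -scalemx1 => E; apply/unitarymxP.
by apply: (scalerI c_neq0); rewrite E.
Qed.
End FrameSymmetry.

(** The next two sections relabel a frame by a permutation mu of its indices;
    the second uses the first in both directions, for mu and for its inverse. *)
Section FrameTransport.

Variables (C : numClosedFieldType) (J : finType) (d : nat).
Variables (Phi Psi : J -> 'cV[C]_d) (mu : {perm J}).
Hypothesis PhiE : forall j, Phi (mu j) = Psi j.

Let PsiE j : Psi ((mu^-1)%g j) = Phi j. Proof. by rewrite -PhiE permKV. Qed.

Lemma vector_induces_conj U f : vector_induces Psi U f -> vector_induces Phi U (f ^ mu)%g.
Proof. by move=> Uf j; rewrite !permM -PsiE Uf PhiE. Qed.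

Lemma line_induces_conj U f : line_induces Psi U f -> line_induces Phi U (f ^ mu)%g.
Proof.
move=> Uf j; rewrite !permM -{1 2}PsiE Uf.
by rewrite /line PhiE.
Qed.

Lemma line_reindex j : line Phi (mu j) = line Psi j.
Proof. by rewrite /line PhiE. Qed.

Lemma frame_reindex_inj (T : Type) (f g : J -> T) :
  (forall j, f (mu j) = g j) -> injective g -> injective f.
Proof.
move=> fg g_inj x y; rewrite -(permKV mu x) -(permKV mu y) !fg.
by move=> /g_inj->.
Qed.

End FrameTransport.

Section SymTransport.

Variables (C : numClosedFieldType) (J : finType) (d : nat).
Variables (Phi Psi : J -> 'cV[C]_d) (mu : {perm J}).
Hypothesis PhiE : forall j, Phi (mu j) = Psi j.

Let PsiE j : Psi ((mu^-1)%g j) = Phi j. Proof. by rewrite -PhiE permKV. Qed.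

Lemma Sym_v_reindex : Sym_v Phi = (Sym_v Psi :^ mu)%G.
Proof.
apply/val_inj/setP => f; rewrite /= mem_conjg; apply/idP/idP; rewrite !inE => -[U uU Uf].
  by exists U => //; exact: (vector_induces_conj PsiE Uf).
by exists U => //; rewrite -(conjgKV mu f); exact: (vector_induces_conj PhiE Uf).
Qed.

Lemma Sym_l_reindex : Sym_l Phi = (Sym_l Psi :^ mu)%G.
Proof.
apply/val_inj/setP => f; rewrite /= mem_conjg; apply/idP/idP; rewrite !inE => -[U uU Uf].
  by exists U => //; exact: (line_induces_conj PsiE Uf).
by exists U => //; rewrite -(conjgKV mu f); exact: (line_induces_conj PhiE Uf).
Qed.

Lemma vector_automorphism_reindex U :
  vector_automorphism Psi U -> vector_automorphism Phi U.
Proof.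
move=> [uU [f Uf]]; split=> //; exists (f ^ mu)%g.
exact: (vector_induces_conj PhiE Uf).
Qed.
End SymTransport.

Section TightFrame.

Variables (C : numClosedFieldType) (J : finType) (d : nat) (Phi : J -> 'cV[C]_d).
Variable c : C.
Hypotheses (c_neq0 : c != 0) (tight : \sum_j line Phi j = c%:M).
Hypothesis Phi_inj : injective Phi.

(** Products of permutations compose from left to right and products of
    matrices from right to left; inverting the permutation makes the
    correspondence multiplicative. *)
Lemma Sym_v_mx_isog :
  mx_isog (Sym_v Phi) [set U | vector_automorphism Phi U]%classic.
Proof.
pose U (f : {perm J}) := synthesis Phi c (f^-1)%g.
have UE f : f \in Sym_v Phi -> vector_induces Phi (U f) (f^-1)%g.
  by rewrite -groupV !inE => -[V _ Vf]; rewrite /U -(vector_inducesE c_neq0 tight Vf).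
have inducesU V f : vector_induces Phi V f -> V = U (f^-1)%g.
  by move=> Vf; rewrite /U invgK; exact: vector_inducesE.
exists U; split.
- rewrite -[1%g]invg1; apply/esym/inducesU => j.
  by rewrite mul1mx perm1.
- move=> f g fS gS; rewrite -[in LHS](invgK (f * g)%g); apply/esym/inducesU => j.
  by rewrite -mulmxA UE // UE // invMg permM.
split.
- move=> f fS; split; last by exists (f^-1)%g; exact: UE.
  exact: (vector_induces_unitary c_neq0 tight (UE _ fS)).
- move=> f g; rewrite !inE => fS gS Ufg; apply: invg_inj; apply/permP => j.
  by apply: Phi_inj; rewrite -UE // -[in RHS]UE // Ufg.
move=> V [uV [f Vf]]; exists (f^-1)%g; last by rewrite -(inducesU _ _ Vf).
by rewrite /= groupV !inE; exists V.
Qed.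
End TightFrame.

Lemma mx_isog_trans (gT hT : finGroupType) (A : {group gT}) (B : {group hT})
    (K : fieldType) n (G : set 'M[K]_n) :
  A \isog B -> mx_isog B G -> mx_isog A G.
Proof.
case/isogP=> f /injmP f_inj fA [g [g1 gM g_bij]].
have fB x : x \in A -> f x \in B by move=> xA; rewrite -fA mem_morphim.
exists (g \o f); split=> [|x y xA yA /=|].
- by rewrite /= morph1.
- by rewrite morphM // gM // fB.
have [gB g_inj g_surj] := g_bij; split.
- by move=> x xA; apply: gB; exact: fB.
- move=> x y; rewrite !inE /= => xA yA /g_inj E; apply: f_inj => //.
  by apply: E; rewrite inE; apply: fB.
move=> U /g_surj[y]; rewrite /= -fA => /morphimP[x _ xA ->] <-.
by exists x.
Qed.

(** * The frame of an additive character and its tournament *)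
Section PaleyFrame.
Variables (F : finFieldType) (h : nat) (C : numClosedFieldType) (psi : F -> C) (a : F).
Hypotheses (card_F : #|F| = h.*2.+1) (h_odd : odd h) (h_gt1 : (1 < h)%N).
Hypothesis psi0 : psi 0 = 1.
Hypothesis psiD : forall x y, psi (x + y) = psi x * psi y.
Hypothesis psi_neq1 : exists x, psi x != 1.
Hypothesis psiN : forall x, (psi x)^* = psi (- x).
Hypothesis a_gen : primitive_element a.

(** The Paley frame, indexed so that the pairing of row u and column t is
    psi (u * t) rather than a dot product of coordinates. *)
Definition char_frame t : 'cV[C]_h := \col_i psi (a ^+ (2 * i) * t).

Local Notation gamma := (gauss_period psi).

Lemma char_frame_gram x y : gram char_frame x y = gamma (y - x).
Proof.
apply: (etrans _ (big_sqr_pow card_F h_odd a_gen (fun u => psi (u * (y - x))))).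
rewrite /gram mxE.
by apply: eq_bigr => i _; rewrite !mxE psiN -psiD mulrBr addrC.
Qed.

Lemma char_frame_tight : \sum_t line char_frame t = (#|F|%:R)%:M.
Proof.
apply/matrixP => i j; rewrite summxE !mxE.
rewrite (eq_bigr (fun t => psi (t * (a ^+ (2 * i) - a ^+ (2 * j))))) => [|t _].
  rewrite (sum_add_char psi0) // subr_eq0 (inj_eq (sqr_pow_inj card_F h_odd a_gen)).
  by case: eqP => _; rewrite ?mulr1n.
by rewrite mxE big_ord1 !mxE psiN -psiD mulrBr ![t * _]mulrC.
Qed.

Definition arc (x y : F) : bool := y - x \in QR F.

Lemma arcC x y : x != y -> arc y x = ~~ arc x y.
Proof.
by move=> xy; rewrite /arc -opprB (QRN card_F) // subr_eq0 eq_sym.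
Qed.

Lemma gamma_arc x y : x != y ->
  gamma (y - x) = gamma 1 ^+ arc x y * gamma (-1) ^+ (1 - arc x y).
Proof.
move=> xy; rewrite /arc; case: (boolP (y - x \in QR F)) => yx /=.
  by rewrite mulr1 expr1 (gauss_period_QR _ card_F).
by rewrite mul1r expr1 (gauss_period_nonQR _ card_F) // subr_eq0 eq_sym.
Qed.

Definition arcs3 x y z : nat := (arc x y + arc y z + arc z x)%N.

(** At z = x and z = y the count is the same for every pair x != y; so
    [Sym_l_arcs3] holds for every z, and one can sum over all of F. *)
Lemma arcs3_ends x y : x != y -> arcs3 x y x = 1%N /\ arcs3 x y y = 1%N.
Proof.
have arcxx z : arc z z = false.
  by rewrite /arc subrr; apply/negP => /(QR_neq0 card_F h_odd)/eqP.
by move=> xy; rewrite /arcs3 (arcC xy) !arcxx; case: (arc x y).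
Qed.

Lemma gram_arcs3 x y z : x != y -> y != z -> z != x ->
  gram char_frame x y * gram char_frame y z * gram char_frame z x =
  gamma 1 ^+ arcs3 x y z * gamma (-1) ^+ (3 - arcs3 x y z).
Proof.
move=> xy yz zx; rewrite !char_frame_gram !gamma_arc // /arcs3.
by case: (arc x y); case: (arc y z); case: (arc z x); rewrite /=; ring.
Qed.

Lemma Sym_l_arcs3 s x y z : s \in Sym_l char_frame -> x != y ->
  arcs3 (s x) (s y) (s z) = arcs3 x y z.
Proof.
move=> sS xy; have sxy : s x != s y by rewrite (inj_eq perm_inj).
have [->|xz] := eqVneq z x; first by rewrite !(proj1 (arcs3_ends _)).
have [->|yz] := eqVneq z y; first by rewrite !(proj2 (arcs3_ends _)).
have arcs3_le u v w : (arcs3 u v w <= 3)%N.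
  by rewrite /arcs3; do 3 case: arc.
apply: (gauss_period_monomial_inj card_F h_odd psi0 psiD psi_neq1) => //.
by rewrite -!gram_arcs3 ?(inj_eq perm_inj) // 1?eq_sym // Sym_l_gram.
Qed.

(** The tournament is regular: every vertex has h arcs out and h arcs in. *)
Lemma sum_arcs3 x y : (\sum_z arcs3 x y z = #|F| * arc x y + h.*2)%N.
Proof.
rewrite /arcs3 !big_split /= sum_nat_const -addnA -addnn; congr (_ + (_ + _))%N.
  rewrite -(card_QR card_F h_odd) -sum1_card [RHS]big_mkcond /=.
  rewrite [RHS](reindex_inj (addIr (- y))) /=; apply: eq_bigr => z _.
  by rewrite /arc; case: ifP.
rewrite -(card_QR card_F h_odd) -sum1_card [RHS]big_mkcond /=.
rewrite [RHS](reindex_inj (inv_inj (subKr x))) /=; apply: eq_bigr => z _.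
by rewrite /arc; case: ifP.
Qed.

(** The sums of [arcs3] over z for (x, y) and its image agree, and they
    determine whether x -> y. *)
Lemma Sym_l_diff_char s : s \in Sym_l char_frame -> diff_char_preserving h s.
Proof.
move=> sS x y; have [->|xy] := eqVneq x y; first by rewrite !subrr.
have sxy : s x != s y by rewrite (inj_eq perm_inj).
apply: (QR_half_inj card_F h_odd); first by rewrite !subr_eq0 (negbTE xy) (negbTE sxy).
suff : arc (s y) (s x) = arc y x by [].
have yx : y != x by rewrite eq_sym.
have := sum_arcs3 (s y) (s x); rewrite (reindex_inj (@perm_inj _ s)) /=.
rewrite (eq_bigr (arcs3 y x)) => [|z _]; last exact: Sym_l_arcs3.
rewrite sum_arcs3 => /addIn/eqP; rewrite eqn_pmul2l ?card_F //.
by case: arc; case: arc.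
Qed.

(** Equal lines at x != y would give eta_0 * eta_1 = h ^ 2, whereas
    2 * eta_0 * eta_1 = h + 1 and h > 1. *)
Lemma char_frame_line_inj : injective (line char_frame).
Proof.
move=> x y lxy; apply/eqP/negPn/negP => xy.
have yx : y - x != 0 by rewrite subr_eq0 eq_sym.
have := mul_line_trace char_frame x y x; rewrite -lxy mul_line_trace !char_frame_gram.
rewrite !subrr (gauss_period0 card_F h_odd psi0).
have -> : gamma (y - x) * gamma (x - y) = gamma 1 * gamma (-1).
  rewrite -(opprB y x); have [yxQ|yxN] := boolP (y - x \in QR F).
    rewrite (gauss_period_QR _ card_F h_odd yxQ); congr (_ * _).
    by rewrite (gauss_period_nonQR _ card_F) ?oppr_eq0 // (QRN card_F) // negbK.
  rewrite mulrC (gauss_period_nonQR _ card_F h_odd yx yxN); congr (_ * _).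
  by rewrite (gauss_period_QR _ card_F) // (QRN card_F).
have h0 : h%:R != 0 :> C by rewrite pnatr_eq0 -lt0n ltnW.
move=> /(mulIf h0) hh.
have := gauss_period_prod card_F h_odd psi0 psiD psi_neq1.
rewrite -hh -!natrM => /eqP; rewrite eqr_nat.
have : (h.+1 < 2 * (h * h))%N by nia.
by rewrite ltn_neqAle eq_sym => /andP[/negbTE->].
Qed.
End PaleyFrame.

(** * Modulations, translation and Galois permutation as affine maps *)
Section PaleyOperators.

Variables (F : finFieldType) (p s : nat) (C : numClosedFieldType).
Variables (psi : F -> C) (a : F).
Local Notation h := ((p ^ s).-1./2).
Hypotheses (card_F : #|F| = h.*2.+1) (h_odd : odd h).
Hypotheses (p_pr : prime p) (card_Fq : #|F| = (p ^ s)%N).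
Hypothesis pcharF : p \in [pchar F].
Hypothesis a_gen : primitive_element a.
Hypothesis psiD : forall x y, psi (x + y) = psi x * psi y.
Hypothesis psi_frob : forall x, psi (x ^+ p) = psi x.

Local Notation phi := (char_frame h psi a).

Let h_gt0 : (0 < h)%N. Proof. by case: (h) h_odd. Qed.
Let a_neq0 : a != 0. Proof. exact: primitive_element_neq0 card_F a_gen. Qed.

Lemma sqr_pow_mod l : a ^+ (2 * (l %% h)) = a ^+ (2 * l).
Proof.
rewrite [in RHS](divn_eq l h) mulnDr exprD.
have -> : (2 * (l %/ h * h) = h.*2 * (l %/ h))%N by rewrite -mul2n mulnCA mulnC.
by rewrite [a ^+ (h.*2 * _)]exprM (expf_half2 card_F) // expr1n mul1r.
Qed.

Lemma mul_index_perm_mx n (f : 'I_n -> 'I_n) (A : 'M[C]_n) (u v : 'cV[C]_n) :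
    injective f -> (forall i j, A i j = (i == f j)%:R) ->
    (forall j, v (f j) 0 = u j 0) ->
  A *m u = v.
Proof.
move=> f_inj AE vE; apply/colP => i; have [g _ gK] := injF_bij f_inj.
rewrite mxE -{2}(gK i) vE (bigD1 (g i)) //= AE gK eqxx mul1r.
rewrite big1 ?addr0 // => j jg; rewrite AE.
by rewrite -{1}(gK i) (inj_eq f_inj) eq_sym (negbTE jg) mul0r.
Qed.

Lemma modulation_char_frame b t :
  diag_mx (phi b)^T *m phi t = phi (t + b).
Proof.
by apply/colP => i; rewrite mul_diag_mx !mxE -psiD -mulrDr addrC.
Qed.

Lemma translation_char_frame t : translation p s C *m phi t = phi (a ^- 2 * t).
Proof.
pose f (j : 'I_h) := Ordinal (ltn_pmod j.+1 h_gt0).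
have fE j : a ^+ (2 * f j) = a ^+ 2 * a ^+ (2 * j).
  by rewrite sqr_pow_mod mulnS exprD.
apply: (mul_index_perm_mx (f := f)) => [i j ij|i j|j].
- apply: (sqr_pow_inj card_F h_odd a_gen); apply: (mulfI (expf_neq0 2 a_neq0)).
  by rewrite -!fE ij.
- by rewrite mxE.
by rewrite !mxE fE mulrC mulrACA mulVf ?expf_neq0 // mul1r mulrC.
Qed.

Lemma galois_perm_char_frame t : galois_perm p s C *m phi t = phi (t ^+ p).
Proof.
pose f (j : 'I_h) := Ordinal (ltn_pmod (p * j) h_gt0).
have fE j : a ^+ (2 * f j) = (a ^+ (2 * j)) ^+ p.
  by rewrite sqr_pow_mod -exprM mulnCA mulnC.
have frob_inj : injective (fun x : F => x ^+ p) := fmorph_inj (pFrobenius_aut pcharF).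
apply: (mul_index_perm_mx (f := f)) => [i j ij|i j|j].
- apply: (sqr_pow_inj card_F h_odd a_gen); apply: frob_inj.
  by rewrite -!fE ij.
- by rewrite mxE.
by rewrite !mxE fE -exprMn psi_frob.
Qed.

(** T shifts the rows, which is undone by dividing the column index by a ^+ 2;
    Pi applies Frobenius to the rows, which psi does not see if it is applied
    to the column index as well. *)
Lemma paley_word_char_frame b l k t :
  diag_mx (phi b)^T *m translation p s C ^+ l *m galois_perm p s C ^+ k *m phi t
  = phi (a ^- (2 * l) * t ^+ (p ^ k) + b).
Proof.
have galE : galois_perm p s C ^+ k *m phi t = phi (t ^+ (p ^ k)).
  elim: k => [|k IHk]; first by rewrite expr1 mul1mx.
  by rewrite exprS -mulmxA IHk galois_perm_char_frame -exprM expnSr.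
have traE u : translation p s C ^+ l *m phi u = phi (a ^- (2 * l) * u).
  elim: l => [|l IHl]; first by rewrite expr0 invr1 mul1mx mul1r.
  by rewrite exprS -mulmxA IHl translation_char_frame mulrA -invfM -exprD mulnS addnC.
by rewrite -!mulmxA galE traE modulation_char_frame.
Qed.

Lemma frob_pow_morph k : {morph (fun x : F => x ^+ (p ^ k)) : x y / x + y}.
Proof. by move=> x y; rewrite exprDn_pchar // pnatX pnatE // pcharF. Qed.

Lemma frob_pow_inj k : injective (fun x : F => x ^+ (p ^ k)).
Proof.
elim: k => [x y|k IHk x y]; first by rewrite !expr1.
rewrite expnSr !exprM => xy; apply: IHk.
exact: (fmorph_inj (pFrobenius_aut pcharF)).
Qed.

(** The polynomials 'X^(p ^ k), k < s, have degree below #|F|, and a generates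
    the nonzero elements: so their values at a tell them apart. *)
Lemma frob_exp_inj (k k' : nat) : (k < s)%N -> (k' < s)%N ->
  a ^+ (p ^ k) = a ^+ (p ^ k') -> k = k'.
Proof.
move=> ks ks' E.
have EX : 'X^(p ^ k) = 'X^(p ^ k') :> {poly F}.
  have lt_q j : (j < s)%N -> (p ^ j < #|F|)%N.
    by move=> js; rewrite card_Fq ltn_exp2l // prime_gt1.
  apply: (@poly_eq_fun _ _ _ predT); rewrite ?size_polyXn ?lt_q // => x _.
  rewrite !hornerXn; have [->|/a_gen[j ->]] := eqVneq x 0.
    by rewrite !expr0n !expn_eq0 !eqn0Ngt prime_gt0.
  by rewrite -!exprM mulnC exprM E -exprM mulnC.
have := congr1 (fun P : {poly F} => size P) EX; rewrite !size_polyXn => -[].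
by apply: expnI; rewrite prime_gt1.
Qed.

Variable P : {poly F}.
Hypotheses (size_P : (size P <= s.+1)%N) (P_neq0 : P != 0) (root_P : root P a).
Hypothesis P_nat : forall i, exists n : nat, P`_i = n%:R.

(** P plays the part of the minimal polynomial of a over the prime field: its
    coefficients are natural numbers, which field endomorphisms fix.  It has at
    most s roots; the s conjugates a ^+ (p ^ k) are roots, and so is f a, hence
    f a is one of them. *)
Lemma field_aut_frob (f : {perm F}) : f \in field_aut_set F ->
  exists2 k, (k < s)%N & forall x, f x = x ^+ (p ^ k).
Proof.
move=> /[dup] fA /field_autP[fD fM].
have f0 : f 0 = 0 by apply: (addrI (f 0)); rewrite -fD !addr0.
have f1 : f 1 = 1.
  by apply: (mulfI (field_aut_neq0 fA (oner_neq0 F))); rewrite -fM !mulr1.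
have fX x n : f (x ^+ n) = f x ^+ n.
  by elim: n => [|n IHn]; rewrite ?expr0 // !exprS fM IHn.
have fnat n : f n%:R = n%:R.
  by elim: n => [|n IHn]; rewrite ?f0 // !mulrS fD IHn f1.
have root_morph (g : F -> F) : g 0 = 0 -> (forall n : nat, g n%:R = n%:R) ->
    {morph g : x y / x + y} -> {morph g : x y / x * y} ->
    (forall x n, g (x ^+ n) = g x ^+ n) -> root P (g a).
  move=> g0 gnat gD gM gX.
  rewrite rootE; apply/eqP; transitivity (g P.[a]); last by rewrite (rootP root_P).
  rewrite !horner_coef (big_morph g gD g0); apply: eq_bigr => i _.
  by have [n ->] := P_nat i; rewrite gM gX gnat.
have root_f : root P (f a) by exact: root_morph.
have root_frob k : root P (a ^+ (p ^ k)).
  apply: (root_morph (fun x => x ^+ (p ^ k))).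
  - by rewrite expr0n expn_eq0 eqn0Ngt prime_gt0.
  - move=> n; elim: k => [|k IHk]; first by rewrite expr1.
    rewrite expnSr exprM IHk; exact: (rmorph_nat (pFrobenius_aut pcharF)).
  - exact: frob_pow_morph.
  - by move=> x y; rewrite exprMn.
  by move=> x n; rewrite -!exprM mulnC.
pose roots := [seq a ^+ (p ^ k) | k <- iota 0 s].
have uniq_roots : uniq roots.
  rewrite map_inj_in_uniq ?iota_uniq // => k k'; rewrite !mem_iota /= add0n.
  exact: frob_exp_inj.
have [|fa_notin] := boolP (f a \in roots).
  case/mapP=> k; rewrite mem_iota /= add0n => ks faE; exists k => // x.
  have [->|/a_gen[j ->]] := eqVneq x 0.
    by rewrite f0 expr0n expn_eq0 eqn0Ngt prime_gt0.
  by rewrite fX faE -!exprM mulnC.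
have := max_poly_roots (rs := f a :: roots) P_neq0.
rewrite /= root_f fa_notin uniq_roots size_map size_iota ltnNge size_P.
have -> : all (root P) roots by apply/allP => _ /mapP[k _ ->].
by move=> /(_ isT isT).
Qed.

End PaleyOperators.

(** * Permutation groups: homogeneity and transitivity *)
Section PermActions.

Variable T : finType.

Lemma homogeneous_conj k (A : {group {perm T}}) (mu : {perm T}) :
  homogeneous k A [set: T] 'P -> homogeneous k (A :^ mu)%G [set: T] 'P.
Proof.
move=> homA X Y _ _ cX cY.
have [|||//|f fA fE] := homA ('P^*%act X mu^-1)%g ('P^*%act Y mu^-1)%g.
- exact: finset.subsetT.
- exact: finset.subsetT.
- by rewrite card_setact.
- by rewrite card_setact.
exists (f ^ mu)%g; first by rewrite memJ_conjg.
by rewrite !actM /= fE actKVin.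
Qed.

Lemma not_two_transitive (A : {group {perm T}}) (u v : T) :
    u != v -> (forall f, f \in A -> f u = v -> f v <> u) ->
  ~~ [transitive^2 A, on [set: T] | 'P].
Proof.
move=> uv no_swap; apply/negP => trA.
have dt x y : x != y -> [tuple x; y] \in 2.-dtuple([set: T]).
  by move=> xy; rewrite inE /= !inE xy; apply/fintype.subsetP => z _; rewrite inE.
have vu : v != u by rewrite eq_sym.
have [f fA /(congr1 val) /= [fu fv]] := atransP2 trA (dt _ _ uv) (dt _ _ vu).
by case: (no_swap f fA).
Qed.

End PermActions.

Section AffineQR.

Variables (F : finFieldType) (h : nat).
Hypotheses (card_F : #|F| = h.*2.+1) (h_odd : odd h).

(** Order each pair so that its difference is a square; then the affine map
    carrying one ordered pair to the other has a square slope. *)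
Lemma AGammaL_QR_homogeneous : homogeneous 2 (AGammaL_QR F) [set: F] 'P.
Proof.
have orient (X : {set F}) : #|X| = 2%N -> exists x y, X = [set x; y] /\ y - x \in QR F.
  move=> /eqP/cards2P[x [y [xy ->]]].
  have [yx|yx] := boolP (y - x \in QR F); first by exists x, y.
  by exists y, x; rewrite finset.setUC -opprB (QRN card_F) // subr_eq0 eq_sym.
move=> X Y _ _ /orient[x [y [-> yx]]] /orient[x' [y' [-> yx']]].
pose m := (y' - x') / (y - x).
have mQ : m \in QR F.
  move: yx yx'; rewrite !(QRE card_F h_odd) exprMn exprVn => /eqP-> /eqP->.
  by rewrite divr1.
have yx0 := QR_neq0 card_F h_odd yx.
have m0 := QR_neq0 card_F h_odd mQ.
pose f := perm (inj_comp (addIr (x' - m * x)) (mulfI m0)).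
have fE t : f t = m * t + (x' - m * x) by rewrite permE.
exists f.
  apply/AGammaL_QRP; exists m, (x' - m * x), 1%g; split=> //.
  by apply/forallP => t; rewrite fE perm1.
rewrite /= /setact imsetU1 imset_set1 /= /aperm !fE.
have -> : m * x + (x' - m * x) = x' by rewrite addrC subrK.
have -> // : m * y + (x' - m * x) = y'.
by rewrite addrCA -mulrBr divfK // addrC subrK.
Qed.

Lemma AGammaL_QR_diff f x y : f \in AGammaL_QR F ->
  (f x - f y \in QR F) = (x - y \in QR F).
Proof.
case/AGammaL_QRP=> m [b [g [mQ gA /forallP fE]]].
have [gD gM] := field_autP _ gA.
have gB : g (x - y) = g x - g y.
  by have := gD (x - y) y; rewrite subrK => ->; rewrite addrK.
rewrite !(eqP (fE _)) opprD addrACA subrr addr0 -mulrBr -gB.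
have mh : m ^+ h = 1 by apply/eqP; rewrite -(QRE card_F h_odd).
rewrite !(QRE card_F h_odd) exprMn mh mul1r.
apply/idP/idP; rewrite -!(QRE card_F h_odd); last exact: field_aut_QR.
rewrite -{2}(permK g (x - y)); apply: field_aut_QR.
by rewrite -[_ \in field_aut_set F]/(_ \in field_aut F) groupV.
Qed.

Lemma AGammaL_QR_no_swap f x y : x != y -> f \in AGammaL_QR F ->
  f x = y -> f y <> x.
Proof.
move=> xy /(AGammaL_QR_diff x y) fA fx fy; move: fA; rewrite fx fy -opprB.
by rewrite (QRN card_F) ?subr_eq0 //; case: (_ \in _).
Qed.

End AffineQR.

(** * The absolute trace and the characters of Frobenius-invariant forms *)
Section FrobeniusTrace.

Variables (F : finFieldType) (p s : nat).
Hypotheses (p_pr : prime p) (s_gt0 : (0 < s)%N) (card_Fq : #|F| = (p ^ s)%N).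
Hypothesis pcharF : p \in [pchar F].

Definition frob_trace (x : F) : F := \sum_(k < s) x ^+ (p ^ k).

Lemma frob_traceD x y : frob_trace (x + y) = frob_trace x + frob_trace y.
Proof.
rewrite -big_split; apply: eq_bigr => k _ /=.
exact: (frob_pow_morph p_pr pcharF).
Qed.

Lemma frob_trace_frob x : frob_trace (x ^+ p) = frob_trace x.
Proof.
have E k : (x ^+ p) ^+ (p ^ k) = x ^+ (p ^ k.+1) by rewrite -exprM expnS.
rewrite /frob_trace; under eq_bigr do rewrite E.
case: (s) card_Fq s_gt0 => // n cF _.
by rewrite big_ord_recr big_ord_recl /= -cF expf_card expn0 expr1 addrC.
Qed.

(** A polynomial of degree p ^ (s - 1) < #|F| with coefficient 1 at 'X does not
    vanish everywhere. *)
Lemma frob_trace_neq0 : exists x, frob_trace x != 0.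
Proof.
apply/existsP; rewrite -[X in is_true X]negbK negb_exists; apply/negP => /forallP tr0.
pose T : {poly F} := \sum_(k < s) 'X^(p ^ k).
have T0 : T = 0.
  apply: (@poly_eq_fun _ _ _ predT); rewrite ?size_poly0 //.
    apply: leq_trans (size_sum _ _ _) _; apply/bigmax_leqP => k _.
    by rewrite size_polyXn card_Fq ltn_exp2l ?prime_gt1.
  move=> x _; rewrite horner0 horner_sum.
  under eq_bigr do rewrite hornerXn.
  by apply/eqP; have := tr0 x; rewrite negbK.
have /eqP := congr1 (fun P : {poly F} => P`_1) T0.
rewrite coef0 coef_sum (bigD1 (Ordinal s_gt0)) //= coefXn expn0 eqxx big1.
  by rewrite addr0 oner_eq0.
move=> k; rewrite -val_eqE /= -lt0n => k_gt0.
by rewrite coefXn ltn_eqF // -{1}(expn0 p) ltn_exp2l ?prime_gt1.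
Qed.

End FrobeniusTrace.

Section AdditiveCharacter.

Variables (F : finFieldType) (p : nat) (C : numClosedFieldType) (zeta : C).
Variable tau : F -> 'F_p.
Hypotheses (p_pr : prime p) (zeta_prim : p.-primitive_root zeta).
Hypothesis tauD : forall x y, tau (x + y) = tau x + tau y.
Hypothesis tau_neq0 : exists x, tau x != 0.

Definition char_of_form (x : F) : C := zeta ^+ (tau x : nat).

Lemma form0 : tau 0 = 0.
Proof. by apply: (addrI (tau 0)); rewrite -tauD !addr0. Qed.

Lemma char_of_form0 : char_of_form 0 = 1.
Proof. by rewrite /char_of_form form0 expr0. Qed.

Lemma char_of_formD x y : char_of_form (x + y) = char_of_form x * char_of_form y.
Proof.
rewrite /char_of_form tauD -exprD /= -[RHS](prim_expr_mod zeta_prim).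
by congr (_ ^+ (_ %% _)); exact: Fp_cast.
Qed.

Lemma char_of_form_neq1 : exists x, char_of_form x != 1.
Proof.
have [x tx] := tau_neq0; exists x.
rewrite /char_of_form -(prim_order_dvd zeta_prim) /dvdn modn_small //.
rewrite -[X in (_ < X)%N](Fp_cast p_pr); exact: ltn_ord.
Qed.

Lemma char_of_formN x : (char_of_form x)^* = char_of_form (- x).
Proof.
have zeta1 : `|zeta| = 1.
  apply/eqP; rewrite -(pexpr_eq1 (prime_gt0 p_pr)) // -normrX.
  by rewrite (prim_expr_order zeta_prim) normr1.
have norm1 : `|char_of_form x| = 1 by rewrite normrX zeta1 expr1n.
have N0 : char_of_form x != 0 by rewrite -normr_eq0 norm1 oner_eq0.
apply: (mulfI N0); rewrite -char_of_formD subrr char_of_form0 -normCK norm1.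
by rewrite expr1n.
Qed.

End AdditiveCharacter.

(** * The symmetry groups of the frame of a Frobenius-invariant character *)
Section CharFrameSymmetry.

Variables (F : finFieldType) (p s : nat) (C : numClosedFieldType).
Variables (psi : F -> C) (a : F).
Local Notation h := ((p ^ s).-1./2).
Hypotheses (card_F : #|F| = h.*2.+1) (h_odd : odd h) (h_gt1 : (1 < h)%N).
Hypotheses (p_pr : prime p) (card_Fq : #|F| = (p ^ s)%N).
Hypothesis pcharF : p \in [pchar F].
Hypothesis a_gen : primitive_element a.
Hypothesis psi0 : psi 0 = 1.
Hypothesis psiD : forall x y, psi (x + y) = psi x * psi y.
Hypothesis psi_neq1 : exists x, psi x != 1.
Hypothesis psiN : forall x, (psi x)^* = psi (- x).
Hypothesis psi_frob : forall x, psi (x ^+ p) = psi x.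
Variable P : {poly F}.
Hypotheses (size_P : (size P <= s.+1)%N) (P_neq0 : P != 0) (root_P : root P a).
Hypothesis P_nat : forall i, exists n : nat, P`_i = n%:R.

Local Notation phi := (char_frame h psi a).

Definition affine_word b l k (t : F) : F := a ^- (2 * l) * t ^+ (p ^ k) + b.

Definition paley_word b l k : 'M[C]_h :=
  diag_mx (phi b)^T *m translation p s C ^+ l *m galois_perm p s C ^+ k.

Lemma affine_word_inj b l k : injective (affine_word b l k).
Proof.
have a0 := primitive_element_neq0 card_F a_gen.
move=> x y /addIr; have /mulfI inj : a ^- (2 * l) != 0 by rewrite invr_eq0 expf_neq0.
by move/inj; exact: (frob_pow_inj pcharF).
Qed.

Lemma frob_perm_aut k : perm (@frob_pow_inj _ _ pcharF k) \in field_aut_set F.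
Proof.
apply/field_autP; split=> x y; rewrite !permE ?exprMn //.
exact: (frob_pow_morph p_pr pcharF).
Qed.

Lemma AGammaL_QR_wordP (f : {perm F}) : f \in AGammaL_QR F ->
  exists b l k, [/\ (l < h)%N, (k < s)%N & f =1 affine_word b l k].
Proof.
case/AGammaL_QRP=> m [b [g [mQ gA /forallP fE]]].
have [k ks gE] := field_aut_frob p_pr card_Fq pcharF a_gen size_P P_neq0 root_P P_nat gA.
(* T acts with slope a ^- 2, so m^-1 is what has to be an even power of a. *)
have : m^-1 \in QR F.
  move: mQ; rewrite !(QRE card_F h_odd) exprVn => /eqP->; exact/eqP/invr1.
rewrite -(imset_sqr_pow card_F h_odd a_gen) => /imsetP[[l /= lh] _ mE].
by exists b, l, k; split=> // x; rewrite (eqP (fE x)) gE /affine_word -mE invrK.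
Qed.

Lemma paley_word_induces (f : {perm F}) b l k : f =1 affine_word b l k ->
  vector_induces phi (paley_word b l k) f.
Proof.
move=> fE t; rewrite fE.
exact: (paley_word_char_frame card_F h_odd pcharF a_gen psiD psi_frob).
Qed.

Let q_neq0 : #|F|%:R != 0 :> C.
Proof. by rewrite card_F pnatr_eq0. Qed.

Let tight := char_frame_tight card_F h_odd psi0 psiD psi_neq1 psiN a_gen.

(** Unitarity comes from tightness: the word permutes the frame vectors. *)
Lemma paley_word_unitary b l k : paley_word b l k \is unitarymx.
Proof.
apply: (vector_induces_unitary q_neq0 tight (s := perm (@affine_word_inj b l k))).
by apply: paley_word_induces => t; rewrite permE.
Qed.

Lemma AGammaL_QR_sub_Sym_v : AGammaL_QR F \subset Sym_v phi.
Proof.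
apply/fintype.subsetP => f /AGammaL_QR_wordP[b [l [k [_ _ fE]]]]; rewrite !inE.
by exists (paley_word b l k); [exact: paley_word_unitary | exact: paley_word_induces].
Qed.

Lemma Sym_l_sub_AGammaL_QR : Sym_l phi \subset AGammaL_QR F.
Proof.
apply/fintype.subsetP => f fS.
have fP := Sym_l_diff_char card_F h_odd h_gt1 psi0 psiD psi_neq1 psiN a_gen fS.
have [m [b [g [mQ gA fE]]]] := diff_char_affine card_F h_odd fP.
by apply/AGammaL_QRP; exists m, b, g; split=> //; apply/forallP => x; rewrite fE.
Qed.

Lemma Sym_v_char_frame : Sym_v phi = AGammaL_QR F.
Proof.
apply/val_inj/eqP; rewrite finset.eqEsubset AGammaL_QR_sub_Sym_v andbT.
exact: (fintype.subset_trans (Sym_v_sub_Sym_l _) Sym_l_sub_AGammaL_QR).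
Qed.

Lemma Sym_l_char_frame : Sym_l phi = AGammaL_QR F.
Proof.
apply/val_inj/eqP; rewrite finset.eqEsubset Sym_l_sub_AGammaL_QR.
exact: (fintype.subset_trans AGammaL_QR_sub_Sym_v (Sym_v_sub_Sym_l _)).
Qed.

Lemma vector_automorphism_char_frame U : vector_automorphism phi U <->
  exists b l k, [/\ (l < h)%N, (k < s)%N & U = paley_word b l k].
Proof.
split=> [[uU [f Uf]]|[b [l [k [_ _ ->]]]]].
  have : f \in Sym_v phi by rewrite !inE; exists U.
  rewrite Sym_v_char_frame => /AGammaL_QR_wordP[b [l [k [lh ks fE]]]].
  exists b, l, k; split=> //.
  rewrite (vector_inducesE q_neq0 tight Uf); apply/esym.
  exact/(vector_inducesE q_neq0 tight)/paley_word_induces.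
split; first exact: paley_word_unitary.
exists (perm (@affine_word_inj b l k)).
by apply: paley_word_induces => t; rewrite permE.
Qed.

End CharFrameSymmetry.

(** * Coordinates, the Paley frame and the semidirect product *)
Section PaleyField.

Variables (p s : nat) (pi : {poly 'F_p}) (mi : monic_irreducible_poly pi).
Local Notation F := {poly %/ pi with mi}.
Local Notation h := ((p ^ s).-1./2).
Local Notation alpha := (alpha mi).
Hypotheses (p_pr : prime p) (size_pi : size pi = s.+1).
Hypotheses (q_gt3 : (3 < p ^ s)%N) (q_mod4 : (p ^ s = 3 %[mod 4])%N).
Hypothesis alpha_gen : primitive_element alpha.

Lemma card_half : #|F| = h.*2.+1.
Proof.
rewrite (card_Fq mi p_pr size_pi) -mul2n (halfE q_gt3 q_mod4) prednK //.
exact: ltn_trans q_gt3.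
Qed.

Lemma odd_half : odd h.
Proof.
have qE : (p ^ s = (p ^ s %/ 4).*2.*2.+3)%N.
  by rewrite -!muln2 -mulnA {1}(divn_eq (p ^ s) 4) q_mod4 addn3.
by rewrite qE /= doubleK /= odd_double.
Qed.

Lemma s_gt0 : (0 < s)%N.
Proof. by move: q_gt3; case: (s). Qed.

Lemma in_qpoly_horner (q : {poly 'F_p}) :
  in_qpoly pi q = (map_poly (qpolyC pi) q).['qX] :> {poly %/ pi}.
Proof. by rewrite -in_qpoly_comp_horner comp_polyXr. Qed.

Lemma root_min_poly : root (map_poly (qpolyC pi) pi : {poly F}) alpha.
Proof.
rewrite rootE; apply/eqP; rewrite -[LHS]in_qpoly_horner.
apply: val_inj; rewrite /= (mk_monicE mi) Pdiv.RingMonic.rmodpp //.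
by case: mi.
Qed.

Lemma map_min_poly_nat i : exists n : nat,
  (map_poly (qpolyC pi) pi : {poly F})`_i = n%:R.
Proof.
exists (nth 0%R pi i : nat).
rewrite coef_map_id0 ?qpolyC0 //.
by rewrite -[in LHS](natr_Zp (nth 0 pi i)) (rmorph_nat (qpolyC pi)).
Qed.

Lemma size_map_min_poly : (size (map_poly (qpolyC pi) pi : {poly F}) <= s.+1)%N.
Proof. by rewrite -size_pi; apply: size_poly. Qed.

Lemma map_min_poly_neq0 : (map_poly (qpolyC pi) pi : {poly F}) != 0.
Proof.
have pi0 : pi != 0 by rewrite -size_poly_gt0 size_pi.
apply: contraNneq pi0 => mp0; apply/eqP; apply: (@map_poly_div_inj _ pi).
by rewrite [LHS]mp0 map_poly0.
Qed.

Lemma coords_expansion (x : F) :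
  x = \sum_(i < s) (coords s x 0 i : nat)%:R * alpha ^+ i.
Proof.
rewrite -{1}(coordsK size_pi x) /of_coords in_qpoly_horner.
rewrite (horner_coef_wide (n := s)); last first.
  exact: leq_trans (size_poly _ _) (size_poly _ _).
apply: eq_bigr => i _; congr (_ * _).
rewrite coef_map_id0 ?qpolyC0 // coef_rVpoly_ord.
by rewrite -[in LHS](natr_Zp (coords s x 0 i)) (rmorph_nat (qpolyC pi)).
Qed.

(** Any coordinate of the trace is invariant under Frobenius because the trace
    is; one of them is nonzero because the trace is. *)
Lemma exists_frob_form : exists tau : F -> 'F_p,
  [/\ forall x y, tau (x + y) = tau x + tau y,
      forall x, tau (x ^+ p) = tau x & exists x, tau x != 0].
Proof.
have cF := card_Fq mi p_pr size_pi.
have [x tr_x] := frob_trace_neq0 p_pr s_gt0 cF.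
have [i xi] : exists i, coords s (frob_trace p s x) 0 i != 0.
  apply/existsP; rewrite -[X in is_true X]negbK negb_exists; apply/negP => /forallP x0.
  case/eqP: tr_x; apply: (can_inj (coordsK size_pi)); apply/rowP => i.
  by have := x0 i; rewrite negbK => /eqP->; rewrite [coords _ _]raddf0 mxE.
exists (fun y => coords s (frob_trace p s y) 0 i); split=> [y z|y|].
- by rewrite frob_traceD ?pchar_Fq // coordsD mxE.
- by rewrite frob_trace_frob // s_gt0.
by exists x.
Qed.

Section Dual.

Variable tau : F -> 'F_p.
Hypothesis tauD : forall x y, tau (x + y) = tau x + tau y.
Hypothesis tau_neq0 : exists x, tau x != 0.

(** [dual c] represents the linear form x |-> tau (x * c) by the dot product;
    the row is read off on the basis alpha ^+ i. *)
Definition dual (c : F) : F := of_coords mi (\row_(i < s) tau (alpha ^+ i * c)).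

Lemma dotp_dual x c : dotp s x (dual c) = tau (x * c).
Proof.
have tau0 := form0 tauD.
have tauMn n y : tau (n%:R * y) = n%:R * tau y.
  elim: n => [|n IHn]; first by rewrite !mul0r tau0.
  by rewrite !mulrS !mulrDl !mul1r tauD IHn.
rewrite {2}(coords_expansion x) mulr_suml (big_morph tau tauD tau0).
apply: eq_bigr => i _; rewrite -mulrA tauMn natr_Zp.
by rewrite /dual (of_coordsK mi size_pi) mxE.
Qed.

Lemma dual_inj : injective dual.
Proof.
move=> c c' cc'; apply/eqP; rewrite -subr_eq0; apply/negPn/negP => c0.
have [x /eqP] := tau_neq0; apply.
have tauB y z : tau (y - z) = tau y - tau z.
  by apply/eqP; rewrite eq_sym subr_eq -tauD subrK.
rewrite -(divfK c0 x) mulrBr tauB -!dotp_dual cc'.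
exact: subrr.
Qed.

End Dual.

Local Notation SD := (paley_semidirect p_pr size_pi q_gt3 q_mod4 alpha_gen).

(** A triple (k, (l, v)) of the semidirect product acts from the right: first
    the power p ^ k of Frobenius, then the square alpha ^+ (2 * l), then the
    translation by v. *)
Definition sd_affine (u : SD) (x : F) : F :=
  alpha ^+ (2 * u.2.1) * x ^+ (p ^ u.1) + of_coords mi u.2.2.

Lemma sd_affine_inj u : injective (sd_affine u).
Proof.
have m0 : alpha ^+ (2 * u.2.1) != 0.
  by rewrite expf_neq0 // (primitive_element_neq0 card_half).
move=> x y /addIr/(mulfI m0); exact: frob_inj.
Qed.

Definition sd_perm u : {perm F} := perm (@sd_affine_inj u).

(** For s = 1 the type 'Z_1 has two elements, but only 0 lies in Zp 1. *)
Lemma sd_index_lt (u : SD) : (u.1 < s)%N.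
Proof.
case: u => [[k v]] /= /setXP[/= Dk _]; have [s_gt1|] := ltnP 1 s.
  by rewrite -[X in (_ < X)%N](Zp_cast s_gt1); exact: ltn_ord.
by move: Dk; rewrite /Zp ltnNge => + s1; rewrite s1 inE => /eqP->; exact: s_gt0.
Qed.

Lemma alpha_Zp_mul (l m : 'Z_h) :
  alpha ^+ (2 * (l * m)%g) = alpha ^+ (2 * m) * alpha ^+ (2 * l).
Proof.
rewrite -exprD -mulnDr addnC -(alpha_mod p_pr size_pi q_gt3 q_mod4 alpha_gen (l + m)).
congr (_ ^+ (2 * (_ %% _))); exact: (Zp_cast (half_gt1 q_gt3 q_mod4)).
Qed.

Lemma alpha_Zp_exp (l : 'Z_h) n : alpha ^+ (2 * (l ^+ n)%g) = (alpha ^+ (2 * l)) ^+ n.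
Proof.
rewrite (val_qr_exp q_gt3 q_mod4) (alpha_mod p_pr size_pi q_gt3 q_mod4 alpha_gen).
by rewrite mulnA exprM.
Qed.

Lemma frob_Zp_mul (k m : 'Z_s) (x : F) : (k < s)%N -> (m < s)%N ->
  x ^+ (p ^ (k * m)%g) = (x ^+ (p ^ k)) ^+ (p ^ m).
Proof.
move=> ks ms; rewrite -exprM -expnD.
have -> : (k * m)%g = ((k + m) %% s)%N :> nat.
  have [s_gt1|s_le1] := ltnP 1 s; first by congr (_ %% _)%N; exact: Zp_cast.
  have := leq_trans ks s_le1; have := leq_trans ms s_le1.
  rewrite !ltnS !leqn0 => /eqP m0 /eqP k0.
  by rewrite /= k0 m0 !mod0n.
apply: (pow_mod (f := fun (x : F) n => x ^+ n)) => [y i j|y].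
  by rewrite exprM.
exact: (frob_s p_pr size_pi).
Qed.

(** Both group laws are right actions, so no inversion occurs. *)
Lemma sd_permM u v : sd_perm (u * v)%g = (sd_perm u * sd_perm v)%g.
Proof.
apply/permP => x; rewrite permM !permE /sd_affine.
rewrite (frobD p_pr) exprMn.
have -> : (u * v)%g.1 = (u.1 * v.1)%g by [].
have -> : (u * v)%g.2.1 = (u.2.1 ^+ (p ^ v.1) * v.2.1)%g by [].
have -> : (u * v)%g.2.2 =
    (qr_act mi (coords s (of_coords mi u.2.2 ^+ (p ^ v.1))) v.2.1 + v.2.2)%R by [].
rewrite alpha_Zp_mul alpha_Zp_exp frob_Zp_mul ?sd_index_lt //.
rewrite of_coordsD /qr_act !(coordsK size_pi) mulrDr !addrA.
by rewrite !mulrA.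
Qed.

Canonical sd_morphism := Morphism (D := [set: SD]) (in2W sd_permM).

Lemma injm_sd_perm : 'injm sd_morphism.
Proof.
apply/injmP => u v _ _ /= /permP uv.
have {}uv x : sd_affine u x = sd_affine v x by have := uv x; rewrite !permE.
have p_gt0 k : (0 < p ^ k)%N by rewrite expn_gt0 prime_gt0.
have v2 : u.2.2 = v.2.2.
  apply: (can_inj (of_coordsK mi size_pi)); have := uv 0.
  by rewrite /sd_affine !expr0n !eqn0Ngt !p_gt0 !mulr0 !add0r.
have lt_h (l : 'Z_h) : (l < h)%N.
  rewrite -[X in (_ < X)%N](Zp_cast (half_gt1 q_gt3 q_mod4)); exact: ltn_ord.
have v1 : u.2.1 = v.2.1.
  have := uv 1; rewrite /sd_affine v2 !expr1n => /addIr; rewrite !mulr1 => E.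
  apply: val_inj.
  have := @sqr_pow_inj _ _ _ card_half odd_half alpha_gen
    (Ordinal (lt_h u.2.1)) (Ordinal (lt_h v.2.1)) E.
  by move/(congr1 val).
have k1 : u.1 = v.1.
  apply: val_inj; apply: (frob_exp_inj p_pr (card_Fq mi p_pr size_pi) alpha_gen);
    rewrite ?sd_index_lt //.
  have := uv alpha; rewrite /sd_affine v2 v1 => /addIr/mulfI; apply.
  by rewrite expf_neq0 // (primitive_element_neq0 card_half).
case: u v v2 v1 k1 {uv} => [[k [[l x] lx]] ku] [[k' [[l' x'] lx']] ku'] /= v2 v1 k1.
by apply: val_inj; rewrite /= k1; congr pair; apply: val_inj; rewrite /= v1 v2.
Qed.

Lemma SD_isog_AGammaL_QR : [set: SD] \isog AGammaL_QR F.
Proof.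
apply/isogP; exists sd_morphism; first exact: injm_sd_perm.
have pF := pchar_Fq mi p_pr.
apply/setP => f; apply/morphimP/AGammaL_QRP.
  case=> u _ _ ->.
  exists (alpha ^+ (2 * u.2.1)), (of_coords mi u.2.2), (perm (@frob_pow_inj _ _ pF u.1)).
  split; last by apply/forallP => x; rewrite /= !permE.
    rewrite mulnC exprM; apply: imset_f.
    by rewrite inE expf_neq0 // (primitive_element_neq0 card_half).
  exact: frob_perm_aut.
case=> m [b [g [mQ gA /forallP fE]]].
have [k ks gE] := field_aut_frob p_pr (card_Fq mi p_pr size_pi) pF alpha_gen
  size_map_min_poly map_min_poly_neq0 root_min_poly map_min_poly_nat gA.
move: mQ; rewrite -(imset_sqr_pow card_half odd_half alpha_gen) => /imsetP[l _ mE].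
have Dk : (inZp k : 'Z_s) \in Zp s.
  have [s_gt1|s_le1] := ltnP 1 s; first by rewrite /Zp s_gt1 inE.
  have k0 : k = 0%N by apply/eqP; rewrite -leqn0 -ltnS (leq_trans ks).
  by rewrite k0 (_ : inZp 0 = 1%g) ?group1 //; apply: val_inj; rewrite /= mod0n.
have Dl : (inZp l : 'Z_h, coords s b) \in finset.setX (Zp h) [set: 'rV['F_p]_s].
  by rewrite !inE andbT; exact: Zp_half_full.
pose w : SD := SdPair (gal_groupAction p_pr size_pi q_gt3 q_mod4 alpha_gen)
  (ax := (inZp k, SdPair (qr_groupAction p_pr size_pi q_gt3 q_mod4 alpha_gen) Dl))
  (introT setXP (conj Dk (finset.in_setT _))).
exists w; rewrite ?inE //; apply/permP => x.
rewrite (eqP (fE x)) gE mE permE /sd_affine /= (coordsK size_pi).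
rewrite !modn_small //.
  by rewrite (leq_trans ks) //; case: (s) => [|[|n]].
by rewrite (leq_trans (ltn_ord l)) //; case: (h) => [|[|n]].
Qed.

Section PaleySymmetry.

Variables (C : numClosedFieldType) (zeta : C).
Hypothesis zeta_prim : p.-primitive_root zeta.

Local Notation Phi := (paley s mi zeta).

(** The frame is [char_frame] relabelled by [dual], so its symmetry groups are
    conjugates of AGammaL_QR, and only isomorphic to it. *)
Lemma paley_symmetry : exists mu : {perm F},
  [/\ Sym_v Phi = (AGammaL_QR F :^ mu)%G,
      Sym_l Phi = (AGammaL_QR F :^ mu)%G,
      [set U | vector_automorphism Phi U]%classic = paley_group s mi zeta,
      injective (line Phi)
    & \sum_x line Phi x = (#|F|%:R)%:M].
Proof.
have [tau [tauD tau_frob tau_neq0]] := exists_frob_form.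
pose psi := char_of_form zeta tau.
pose phi := char_frame h psi alpha.
have psi0 : psi 0 = 1 := char_of_form0 zeta tauD.
have psiD : forall x y, psi (x + y) = psi x * psi y := char_of_formD p_pr zeta_prim tauD.
have psi1 : exists x, psi x != 1 := char_of_form_neq1 p_pr zeta_prim tau_neq0.
have psiN : forall x, (psi x)^* = psi (- x) := char_of_formN p_pr zeta_prim tauD.
have psi_frob x : psi (x ^+ p) = psi x by rewrite /psi /char_of_form tau_frob.
have h1 := half_gt1 q_gt3 q_mod4.
have pF := pchar_Fq mi p_pr; have cq := card_Fq mi p_pr size_pi.
pose mu := perm (dual_inj tauD tau_neq0); exists mu.
have muE t : Phi (mu t) = phi t.
  by apply/colP => i; rewrite !mxE permE dotp_dual.
have muVE t : phi ((mu^-1)%g t) = Phi t by rewrite -muE permKV.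
split.
- rewrite (Sym_v_reindex muE).
  by rewrite (Sym_v_char_frame card_half odd_half h1 p_pr cq pF alpha_gen psi0 psiD
    psi1 psiN psi_frob size_map_min_poly map_min_poly_neq0 root_min_poly
    map_min_poly_nat).
- rewrite (Sym_l_reindex muE).
  by rewrite (Sym_l_char_frame card_half odd_half h1 p_pr cq pF alpha_gen psi0 psiD
    psi1 psiN psi_frob size_map_min_poly map_min_poly_neq0 root_min_poly
    map_min_poly_nat).
- have phiE := vector_automorphism_char_frame card_half odd_half h1 p_pr cq pF
    alpha_gen psi0 psiD psi1 psiN psi_frob size_map_min_poly map_min_poly_neq0
    root_min_poly map_min_poly_nat.
  apply/seteqP; split=> U.
    move/(vector_automorphism_reindex muVE)/phiE => [b [l [k [lh ks ->]]]].
    by exists (mu b), l, k; rewrite /modulation muE.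
  case=> b [l [k [lh ks ->]]]; apply: (vector_automorphism_reindex muE).
  apply/phiE; exists ((mu^-1)%g b), l, k; split=> //.
  by rewrite /paley_word -/phi muVE.
- apply: (frame_reindex_inj (line_reindex muE)).
  exact: (char_frame_line_inj card_half odd_half h1 psi0 psiD psi1 psiN alpha_gen).
rewrite (reindex_inj (@perm_inj _ mu)) /=.
rewrite (eq_bigr (line phi)) => [|t _]; last by rewrite (line_reindex muE).
exact: (char_frame_tight card_half odd_half psi0 psiD psi1 psiN alpha_gen).
Qed.

End PaleySymmetry.
End PaleyField.

(** * Symmetry of the Paley equiangular tight frame *)
Local Open Scope complex_scope.

Theorem theorem2p19 (R : realType) (p s : nat) (pi : {poly 'F_p})
    (mi : monic_irreducible_poly pi) (zeta : R[i])
    (p_pr : prime p) (size_pi : size pi = s.+1)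
    (q_gt3 : (3 < p ^ s)%N) (q_mod4 : (p ^ s = 3 %[mod 4])%N)
    (alpha_gen : primitive_element (alpha mi))
    (zeta_prim : p.-primitive_root zeta) :
  let F := {poly %/ pi with mi} in
  let Phi := paley s mi zeta in
  let G := paley_group s mi zeta in
  let SD := paley_semidirect p_pr size_pi q_gt3 q_mod4 alpha_gen in
  [/\ [set U | vector_automorphism Phi U]%classic = G,
      mx_isog [set: SD]%G G /\ [set: SD] \isog AGammaL_QR F,
      Sym_v Phi = Sym_l Phi /\ mx_isog (Sym_v Phi) G,
      injective Phi /\ injective (line Phi)
    & [/\ homogeneous 2 (Sym_v Phi) [set: F] 'P,
          ~~ [transitive^2 Sym_v Phi, on [set: F] | 'P],
          homogeneous 2 (Sym_l Phi) [set: F] 'P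
        & ~~ [transitive^2 Sym_l Phi, on [set: F] | 'P]]].
Proof.
move=> F Phi G SD.
have cF := card_half mi p_pr size_pi q_gt3 q_mod4.
have hodd := odd_half q_mod4.
have [mu [SvE SlE vaE line_inj tight]] :=
  paley_symmetry p_pr size_pi q_gt3 q_mod4 alpha_gen zeta_prim.
have Phi_inj : injective Phi by move=> x y xy; apply: line_inj; rewrite /line -/Phi xy.
have q_neq0 : #|F|%:R != 0 :> R[i] by rewrite cF pnatr_eq0.
have Sv_isog : mx_isog (Sym_v Phi) G.
  by rewrite /G -vaE; exact: (Sym_v_mx_isog q_neq0 tight Phi_inj).
have SD_isog := SD_isog_AGammaL_QR p_pr size_pi q_gt3 q_mod4 alpha_gen.
have hom : homogeneous 2 (Sym_v Phi) [set: F] 'P.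
  by rewrite SvE; exact/homogeneous_conj/(AGammaL_QR_homogeneous cF hodd).
have not_2trans : ~~ [transitive^2 Sym_v Phi, on [set: F] | 'P].
  rewrite SvE; apply: (@not_two_transitive _ _ (mu 0) (mu 1)).
    by rewrite (inj_eq perm_inj) eq_sym oner_eq0.
  move=> f; rewrite mem_conjg => fA f01 f10.
  apply: (AGammaL_QR_no_swap cF hodd _ fA (x := 0) (y := 1)).
  - by rewrite eq_sym oner_eq0.
  - by rewrite !permM invgK f01 permK.
  by rewrite !permM invgK f10 permK.
have SvSl : Sym_v Phi = Sym_l Phi by rewrite SvE SlE.
split=> //; last by rewrite -SvSl.
split=> //; apply: (mx_isog_trans SD_isog).
apply: mx_isog_trans Sv_isog; rewrite SvE; exact: conj_isog.
Qed.
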